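(* Let $e,m,n$ be integers with $2\le m<n\le e-2$. The Sally type numerical semigroup $S^e(m,n)$ is Gorenstein if and only if $(m,n)=(2,3)$.
   Context: For integers $e,m,n$ with $2\le m<n\le e-2$, $S^e(m,n)$ denotes the Sally type numerical semigroup, i.e. the numerical semigroup (submonoid of $(\mathbb N,+)$, with $0\in\mathbb N$) minimally generated by $\{e,e+1,\ldots,2e-1\}\setminus\{e+m,e+n\}$. A numerical semigroup $S$ is called Gorenstein if its semigroup ring $k[S]=k[t^s : s\in S]\subset k[t]$ ($k$ a field) is a Gorenstein ring. It is a standard fact that this is equivalent to $S$ being symmetric, i.e. to $(F(S)+1)/2=g(S)$, where $F(S)$ is the greatest integer not in $S$ and $g(S)=|\mathbb N\setminus S|$; in particular it does not depend on $k$. *)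

(* Defs.v *)
From HB Require Import structures.
From mathcomp Require Import all_boot all_order all_algebra.
From mathcomp Require Import boolp classical_sets cardinality.
From mathcomp Require Import zify.

Set Implicit Arguments.
Unset Strict Implicit.
Unset Printing Implicit Defensive.

Import GRing.Theory.

Local Open Scope classical_set_scope.

(** * Numerical semigroups *)

Definition submonoid_closed (S : set nat) : Prop :=
  S 0%N /\ forall x y : nat, S x -> S y -> S (x + y)%N.

Record natSubmonoid := NatSubmonoid {
  submonoid_set :> set nat ;
  submonoidP : submonoid_closed submonoid_set }.

Definition numerical_semigroup (S : natSubmonoid) : Prop :=
  finite_set (~` (S : set nat)).

Lemma smallest_submonoid_closed (A : set nat) :
  submonoid_closed (smallest submonoid_closed A).
Proof.
split=> [M [[M0 _] _] //|x y Sx Sy M [[M0 MD] AM]].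
have CM : [set M | submonoid_closed M /\ A `<=` M] M by [].
by apply: MD; [exact: (Sx M CM) | exact: (Sy M CM)].
Qed.

Definition generated (A : set nat) : natSubmonoid :=
  NatSubmonoid (smallest_submonoid_closed A).

Definition minimally_generated (S : natSubmonoid) (A : set nat) : Prop :=
  S = generated A /\ forall a, A a -> ~ (generated (A `\ a) : set nat) a.

Definition sally_generators (e m n : nat) : set nat :=
  [set x | (e <= x <= 2 * e - 1)%N] `\` [set (e + m)%N; (e + n)%N].

Definition sally (e m n : nat) : natSubmonoid :=
  generated (sally_generators e m n).

Lemma sally_minimally_generated (e m n : nat) :
  (2 <= m)%N -> (m < n)%N -> (n <= e - 2)%N ->
  minimally_generated (sally e m n) (sally_generators e m n).
Proof.
move=> m2 mn ne; split=> // a [/= ae _] Sa.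
have : [set x | x = 0%N \/ ((e <= x)%N /\ x <> a)] a.
  apply: (Sa [set x | x = 0%N \/ ((e <= x)%N /\ x <> a)]); split.
    by split=> [|x y /=]; [left | lia].
  by move=> x [[/= xe _] xa]; right; split; [lia | exact: xa].
by move=> /=; lia.
Qed.

Lemma sally_numerical_semigroup (e m n : nat) :
  (2 <= m)%N -> (m < n)%N -> (n <= e - 2)%N ->
  numerical_semigroup (sally e m n).
Proof.
move=> m2 mn ne; apply: (@sub_finite_set _ _ `I_(e * e)); last first.
  exact: finite_II.
move=> x /= xS; rewrite ltnNge; apply/negP => xee; apply: xS.
move=> M [[M0 MD] AM].
have Me : M e by apply: AM; split=> /=; lia.
have Me1 : M e.+1 by apply: AM; split=> /=; lia.
have Mmul a k : M a -> M (k * a)%N.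
  by move=> Ma; elim: k => [|k IH]; rewrite ?mul0n // mulSn; apply: MD.
have e0 : (0 < e)%N by lia.
have re : (x %% e < e)%N by rewrite ltn_mod.
have qe : (e <= x %/ e)%N by rewrite leq_divRL.
have -> : x = ((x %/ e - x %% e) * e + (x %% e) * e.+1)%N.
  rewrite {1}(divn_eq x e) mulnS mulnBl.
  have : (x %% e * e <= x %/ e * e)%N by rewrite leq_mul2r; lia.
  lia.
by apply: MD; apply: Mmul.
Qed.

(** * Semigroup rings *)

Local Open Scope ring_scope.

(** k[S] = k[t^s : s in S] consists of the polynomials supported on S; see
    [semigroup_polyE]. *)
Definition semigroup_poly (k : fieldType) (S : natSubmonoid) :
    {pred {poly k}} :=
  fun p => `[< forall i : nat, p`_i != 0 -> (S : set nat) i >].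

Lemma semigroup_poly_subring_closed (k : fieldType) (S : natSubmonoid) :
  subring_closed (@semigroup_poly k S).
Proof.
have [S0 SD] := submonoidP S; split=> [|p q /asboolP Sp /asboolP Sq|p q].
- apply/asboolP=> i; rewrite coef1; case: i => [//|i].
  by rewrite eqxx.
- apply/asboolP=> i; rewrite coefB.
  by have [->|/Sp //] := eqVneq p`_i 0; rewrite sub0r oppr_eq0; apply: Sq.
- move=> /asboolP Sp /asboolP Sq; apply/asboolP=> i; rewrite coefM => pqi.
  apply: contrapT => Si; move/eqP: pqi; apply.
  apply: big1 => j _; have [->|/Sp Sj] := eqVneq p`_j 0; first by rewrite mul0r.
  have [->|/Sq Sij] := eqVneq q`_(i - j) 0; first by rewrite mulr0.
  have ji : (j <= i)%N by rewrite -ltnS.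
  by case: Si; rewrite -(subnKC ji); apply: SD.
Qed.

HB.instance Definition _ (k : fieldType) (S : natSubmonoid) :=
  GRing.isSubringClosed.Build {poly k} (@semigroup_poly k S)
    (@semigroup_poly_subring_closed k S).

Record semigroup_ring (k : fieldType) (S : natSubmonoid) := SemigroupRing {
  semigroup_ring_val :> {poly k} ;
  semigroup_ringP : semigroup_ring_val \in @semigroup_poly k S }.

HB.instance Definition _ (k : fieldType) (S : natSubmonoid) :=
  [isSub for @semigroup_ring_val k S].
HB.instance Definition _ (k : fieldType) (S : natSubmonoid) :=
  [Choice of semigroup_ring k S by <:].
HB.instance Definition _ (k : fieldType) (S : natSubmonoid) :=
  [SubChoice_isSubComNzRing of semigroup_ring k S by <:].

Lemma semigroup_polyE (k : fieldType) (S : natSubmonoid) :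
  [set` @semigroup_poly k S] =
  smallest (fun B : set {poly k} => subalg_closed [pred p | `[< B p >]])
           [set 'X^s | s in (S : set nat)].
Proof.
apply/seteqP; split=> p /=.
  move=> /asboolP Sp B [[B1 BZ BM] XB].
  have {}BZ (a : k) u v : B u -> B v -> B (a *: u + v).
    by move=> Bu Bv; apply/asboolP/BZ; apply/asboolP.
  have B0 : B 0.
    have B1' : B 1 by apply/asboolP.
    by have := BZ (-1) _ _ B1' B1'; rewrite scaleN1r addNr.
  rewrite -[p]coefK poly_def; elim/big_ind: _ => // [u v Bu Bv|i _].
    by have := BZ 1 _ _ Bu Bv; rewrite scale1r.
  have [->|/Sp Si] := eqVneq p`_i 0; first by rewrite scale0r.
  have BX : B 'X^i by apply: XB; exists (i : nat).
  by have := BZ p`_i _ _ BX B0; rewrite addr0.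
apply: (_ : smallest _ _ `<=` [set` @semigroup_poly k S]) => //.
apply: smallest_sub.
  have [S1 SB SM] := @semigroup_poly_subring_closed k S.
  have memE q : (q \in [pred p | `[< [set` @semigroup_poly k S] p >]]) =
                (q \in @semigroup_poly k S) by rewrite inE asboolb.
  split=> [|a u v|u v]; rewrite !memE //; last exact: SM.
  move=> /asboolP Su /asboolP Sv; apply/asboolP=> i; rewrite coefD coefZ.
  have [->|/Su //] := eqVneq u`_i 0.
  by rewrite mulr0 add0r; apply: Sv.
move=> _ [s Ss <-]; apply/asboolP=> i; rewrite coefXn.
by have [->|_] := eqVneq i s; rewrite ?eqxx.
Qed.

(** * Gorenstein rings *)

Definition ideal (R : comNzRingType) (I : set R) : Prop :=
  [/\ I 0, (forall x y, I x -> I y -> I (x + y)) &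
      forall a x, I x -> I (a * x)].

Definition maximal_ideal (R : comNzRingType) (M : set R) : Prop :=
  [/\ ideal M, ~ M 1 &
      forall J : set R, ideal J -> M `<=` J -> ~ J 1 -> J = M].

Definition noetherian (R : comNzRingType) : Prop :=
  forall I : set R, ideal I ->
    exists s : seq R,
      I = [set x | exists c : 'I_(size s) -> R, x = \sum_i c i * s`_i].

(** [phi : R -> L] exhibits [L] as the localization of [R] at the prime
    ideal [P]; this determines [L] up to unique isomorphism over [R]. *)
Definition is_localization_at (R : comNzRingType) (P : set R)
    (L : comUnitRingType) (phi : {rmorphism R -> L}) : Prop :=
  [/\ forall s, ~ P s -> phi s \is a GRing.unit,
      forall x, exists a s, ~ P s /\ x = phi a / phi s &
      forall a, phi a = 0 <-> exists2 s, ~ P s & s * a = 0].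

Definition injective_module (R : comNzRingType) (E : lmodType R) : Prop :=
  forall (A B : lmodType R) (i : {linear A -> B}) (f : {linear A -> E}),
    injective i -> exists g : {linear B -> E}, forall x, g (i x) = f x.

(** There is an exact sequence 0 -> V -> E_0 -> E_1 -> ... of modules with all
    E_i injective, and E_i = 0 for i > d. *)
Definition injective_dimension_le (R : comNzRingType) (V : lmodType R)
    (d : nat) : Prop :=
  exists (E : nat -> lmodType R) (eta : {linear V -> E 0%N})
         (delta : forall i : nat, {linear E i -> E i.+1}),
    [/\ injective eta,
        (forall y, delta 0%N y = 0 <-> exists x, eta x = y),
        (forall i y, delta i.+1 y = 0 <-> exists x, delta i x = y),
        (forall i, injective_module (E i)) &
        forall i, (d < i)%N -> forall x : E i, x = 0].

Definition finite_injective_dimension (R : comNzRingType) (V : lmodType R) :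
    Prop := exists d : nat, injective_dimension_le V d.

(** A Noetherian ring is Gorenstein if its localization at every maximal ideal
    has finite injective dimension as a module over itself. *)
Definition gorenstein (R : comNzRingType) : Prop :=
  noetherian R /\
  forall (M : set R) (L : comUnitRingType) (phi : {rmorphism R -> L}),
    maximal_ideal M -> is_localization_at M phi ->
    finite_injective_dimension (L^o : lmodType L).

Definition gorenstein_semigroup (k : fieldType) (S : natSubmonoid) : Prop :=
  gorenstein (semigroup_ring k S).

(* Main.v *)
Require Import Defs.
From HB Require Import structures.
From mathcomp Require Import all_boot all_algebra.
From mathcomp Require Import boolp classical_sets.
From mathcomp Require Import zify ring.

Set Implicit Arguments.
Unset Strict Implicit.
Unset Printing Implicit Defensive.

Import GRing.Theory.
Local Open Scope classical_set_scope.
Local Open Scope ring_scope.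

(** Write R = k[S] and t for the variable.  The theorem splits into a general
    fact about numerical semigroup rings and a computation with S = S^e(m,n).

    Every integer from 2e on lies in S, except 2e+3 when (m,n) = (2,3): the
    only ways to write 3 as a sum of two numbers from 0 to e-1 are 0+3 and 1+2,
    and both are then excluded.  So for (m,n) = (2,3) the semigroup is symmetric
    with largest gap F = 2e+3, while in all other cases e+m and e+n are two
    different pseudo-Frobenius numbers, that is, gaps a with a+s in S for every
    positive s in S ([sallyP], [sally_symmetric], [sally_pseudo_frobenius]).

    A symmetric semigroup has a Gorenstein ring ([symmetric_gorenstein]).  Let L
    be the localization of R at a maximal ideal and K = k(t).  In the exact
    sequence 0 -> L -> K -> K/L -> 0 the module K is injective, and what is
    left is to show that K/L is injective, for which Baer's criterion asks to
    extend maps from ideals I of L to K/L.  If L contains the inverse of an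
    element of R without constant term, then L contains k[t] and is a principal
    ideal ring, and divisibility of K/L is enough.  Otherwise L is the
    localization at the origin.  Then I contains some t^c that the map kills.
    Composing the map with the functional that reads off the coefficient of
    t^F gives a k-linear functional on I; it is extended to all polynomials.  By
    symmetry of S the pairing (f, g) |-> (coefficient of t^(c+F) in f g) on
    R/t^c R is perfect, so the extended functional is the pairing with some w,
    and multiplication by w/t^c extends the original map
    ([origin_extension_conductor]).

    If S has two pseudo-Frobenius numbers a and a', then R is not Gorenstein
    ([not_gorenstein]).  Localize at the origin, with maximal ideal m.  Let
    x = t^e for some positive e in S.  Then t^(a+e) and t^(a'+e) are killed by
    m modulo x and are independent modulo x.  If L had a finite injective
    resolution with cocycle modules C_i, then descending induction on i >= 1
    would give Ext^1(L/J, C_i) = 0 for all the ideals J of a chain that ends at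
    (x, t^(a+e)): C_i is divisible by x for i >= 1, and this turns
    Ext^1(L/(x,u), C_(i+1)) = 0 into Ext^1(L/m, C_i) = 0 ([extends_kernel]),
    whence Ext^1(L/J, C_i) = 0 along the chain ([extends_chain]).  For i = 1
    one more such step forces t^(a'+e) into (x, t^(a+e)) ([socle_one_dim]),
    which is impossible for degree reasons ([socle_independent]). *)

(** * Injective modules and Baer's criterion *)

Section Baer.
Variable R : comNzRingType.

Definition submodule (V : lmodType R) (U : set V) :=
  U 0 /\ forall a u v, U u -> U v -> U (a *: u + v).

(** The graph of a linear map defined on a submodule of V.  Graphs spare the
    construction of a module structure on each domain of definition, and their
    unions along chains are again graphs. *)
Definition linear_graph (V E : lmodType R) (G : set (V * E)) :=
  submodule G /\ forall y, G (0, y) -> y = 0.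

Definition baer (E : lmodType R) :=
  forall G : set (R^o * E), linear_graph G ->
    exists z, forall r y, G (r, y) -> y = r *: z.

Lemma linear_graph_inj (V E : lmodType R) (G : set (V * E)) v y z :
  linear_graph G -> G (v, y) -> G (v, z) -> y = z.
Proof.
move=> [[G0 GD] GI] Gy Gz; apply/eqP; rewrite eq_sym -subr_eq0; apply/eqP/GI.
have := GD (-1) _ _ Gy Gz.
by rewrite scaleN1r -[_ + _]/(- v + v, - y + z) addNr addrC.
Qed.

Lemma linear_graph_bigcup (V E : lmodType R) (F : set (set (V * E))) A0 :
  F A0 -> total_on F subset -> (forall A, F A -> linear_graph A) ->
  linear_graph (\bigcup_(A in F) A).
Proof.
move=> FA0 Ft FG; split; first split.
- by exists A0 => //; case: (FG _ FA0) => [[]].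
- move=> a u v [A FA Au] [B FB Bv].
  case: (Ft _ _ FA FB) => [AB|BA].
    by exists B => //; case: (FG _ FB) => [[_ BD] _]; apply: BD => //; apply: AB.
  by exists A => //; case: (FG _ FA) => [[_ AD] _]; apply: AD => //; apply: BA.
- by move=> y [A /FG[_ AI] /AI].
Qed.

(** The scalars r with r b in the domain of G form an ideal.  By the Baer
    condition the map r |-> G(r b) on it is multiplication by some z, and z can
    be taken as the value at b. *)
Lemma linear_graph_add (V E : lmodType R) (G : set (V * E)) (b : V) :
  baer E -> linear_graph G ->
  exists2 G', linear_graph G' & G `<=` G' /\ exists z, G' (b, z).
Proof.
move=> EB GL; have [[G0 GD] GI] := GL.
pose H : set (R^o * E) := [set p | G ((p.1 : R) *: b, p.2)].
have HL : linear_graph H.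
  split=> [|y]; last by rewrite /H /= scale0r; apply: GI.
  split=> [|a u v Hu Hv]; first by rewrite /H /= scale0r.
  by have := GD a _ _ Hu Hv; rewrite /H /= scalerDl -scalerA.
have [z Hz] := EB _ HL.
exists [set p | exists c r, G (c, p.2 - r *: z) /\ p.1 = c + r *: b].
  split; first split.
  - by exists 0, 0; rewrite !scale0r subr0 addr0.
  - move=> a u v [c [r [Gc uE]]] [c' [r' [Gc' vE]]].
    exists (a *: c + c'), (a * r + r'); split=> /=.
      have := GD a _ _ Gc Gc'; congr (G (_, _)) => /=.
      by rewrite scalerBr scalerA scalerDl opprD addrACA.
    by rewrite uE vE scalerDr scalerA scalerDl addrACA.
  - move=> y [c [r /= [Gc /esym/eqP]]]; rewrite addr_eq0 => /eqP cE.
    have : H (- r : R, y - r *: z) by rewrite /H /= scaleNr -cE.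
    by move/Hz/eqP; rewrite scaleNr subr_eq addNr => /eqP.
split; first by move=> [u y] Gu; exists u, 0; rewrite !scale0r subr0 addr0.
by exists z, 0, 1; rewrite !scale1r subrr add0r.
Qed.

(** A maximal extension exists by Zorn's lemma and is total by
    [linear_graph_add].  Over a field this is the extension of linear
    functionals. *)
Lemma linear_graph_extend (V E : lmodType R) (G : set (V * E)) :
  baer E -> linear_graph G ->
  exists g : {linear V -> E}, forall v y, G (v, y) -> g v = y.
Proof.
move=> EB GL.
(* Taking the union with G makes P hold of the union of the empty chain. *)
pose P (A : set (V * E)) := linear_graph (G `|` A).
have [F FP Ft|A [PA Amax]] := @Zorn_bigcup _ P.
  have [[A0 FA0]|Fempty] := pselect (exists A, F A); last first.
    suff -> : \bigcup_(X in F) X = set0 by rewrite /P setU0.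
    by apply/seteqP; split=> // p [A FA]; case: Fempty; exists A.
  rewrite /P (_ : G `|` _ = \bigcup_(B in [set G `|` X | X in F]) B); last first.
    apply/seteqP; split=> p; first case.
    - by move=> Gp; exists (G `|` A0); [exists A0|left].
    - by move=> [X FX Xp]; exists (G `|` X); [exists X|right].
    - by move=> [_ [X FX <-] [Gp|Xp]]; [left|right; exists X].
  apply: (@linear_graph_bigcup _ _ _ (G `|` A0)); first by exists A0.
    move=> _ _ [X FX <-] [Y FY <-].
    by case: (Ft _ _ FX FY) => XY; [left|right]; apply: setUS.
  by move=> _ [X FX <-]; apply: FP.
have [[G0 GD] GI] := PA.
have tot v : exists y, (G `|` A) (v, y).
  have [G' G'L [sub [z G'z]]] := linear_graph_add v EB PA.
  exists z; apply: contrapT => nGz; apply: (Amax G') => //.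
    split; first by move=> ? Ap; apply: sub; right.
    by move=> /(_ _ G'z) Az; apply: nGz; right.
  rewrite /P (_ : G `|` G' = G') //; apply/setUidPr => p Gp.
  by apply: sub; left.
pose g v := projT1 (cid (tot v)).
have gP v : (G `|` A) (v, g v) by rewrite /g; case: cid.
have glin : linear g.
  by move=> a u v; apply: (linear_graph_inj PA (gP _)); exact: (GD a _ _ (gP u) (gP v)).
pose gL := GRing.isLinear.Build _ _ _ _ g glin.
pose g' : {linear V -> E} := HB.pack g gL.
exists g' => v y Gv; apply: (linear_graph_inj PA (gP v)); by left.
Qed.

Lemma baer_injective (E : lmodType R) : baer E -> injective_module E.
Proof.
move=> EB A B i f inj_i.
have [|g gE] := @linear_graph_extend B E [set (i a, f a) | a in setT] EB; last first.
  by exists g => x; apply: gE; exists x.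
split; first split.
- by exists 0; rewrite ?linear0.
- by move=> a _ _ [u _ <-] [v _ <-]; exists (a *: u + v); rewrite ?linearP.
- by move=> y [a _ [ia <-]]; rewrite (_ : a = 0) ?linear0 //; apply: inj_i; rewrite linear0.
Qed.

End Baer.

Section Submodules.
Variables (R : comNzRingType) (V : lmodType R) (U : set V).
Hypothesis Usub : submodule U.

(** The proof is an argument so that unification finds it when it looks for the
    closure properties of the predicate. *)
Definition submodule_pred & submodule U : {pred V} := fun v => `[< U v >].
Lemma submodule_pred_closed : submod_closed (submodule_pred Usub).
Proof.
have [U0 UD] := Usub.
split=> [|a u v]; rewrite !unfold_in; first exact/asboolP.
by move=> /asboolP Uu /asboolP Uv; apply/asboolP/UD.
Qed.
HB.instance Definition _ :=
  GRing.isSubmodClosed.Build R V (submodule_pred Usub) submodule_pred_closed.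

Record submodule_type := SubmoduleType {
  submodule_val :> V; _ : submodule_val \in submodule_pred Usub }.
HB.instance Definition _ := [isSub for submodule_val].
HB.instance Definition _ := [Choice of submodule_type by <:].
HB.instance Definition _ := [SubChoice_isSubLmodule of submodule_type by <:].

End Submodules.

(** The graph G is itself a module, which the first projection embeds in R.
    Extending the second projection along this embedding gives the map. *)
Lemma injective_baer (R : comNzRingType) (E : lmodType R) :
  injective_module E -> baer E.
Proof.
move=> Einj G [Gsub GI].
pose S := submodule_type Gsub.
pose i : {linear S -> R^o} := fst \o (val : S -> _).
pose f : {linear S -> E} := snd \o (val : S -> _).
have GS (s : S) : G (i s, f s) by case: s => [[a b] /= /asboolP].
have S0 (s : S) : i s = 0 -> f s = 0 -> s = 0.
  by move=> is0 fs0; apply: val_inj; case: s is0 fs0 => [[a b] Gs] /= -> ->.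
have [|g gE] := Einj S R^o i f.
  move=> p q ipq; apply/eqP; rewrite -subr_eq0; apply/eqP.
  have ipq0 : i (p - q) = 0 by rewrite linearB ipq subrr.
  by apply: S0 => //; apply: GI; rewrite -ipq0.
exists (g 1) => r y Gry.
have Sp : (r, y) \in submodule_pred Gsub by rewrite unfold_in; apply/asboolP.
have := gE (SubmoduleType Sp); rewrite /i /f /= => <-.
by rewrite -linearZ /= [_ *: _]mulr1.
Qed.

Section Quotients.
Variables (R : comNzRingType) (V : lmodType R) (U : set V).
Hypothesis Usub : submodule U.

Let U0 : U 0. Proof. by case: Usub. Qed.
Let UD u v : U u -> U v -> U (u + v).
Proof. by case: Usub => _ + Uu Uv => /(_ 1 _ _ Uu Uv); rewrite scale1r. Qed.
Let UZ a u : U u -> U (a *: u).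
Proof. by case: Usub => _ + Uu => /(_ a _ _ Uu U0); rewrite addr0. Qed.
Let UN u : U u -> U (- u).
Proof. by rewrite -scaleN1r; apply: UZ. Qed.

Definition quotient_rel & submodule U : rel V := fun u v => `[< U (u - v) >].
Lemma quotient_rel_equiv : equiv_class_of (quotient_rel Usub).
Proof.
split=> [u|u v|v u w]; rewrite /quotient_rel ?subrr.
- exact/asboolP.
- by apply/asbool_equiv_eq; split=> /UN; rewrite opprB.
- by move=> /asboolP Uu /asboolP Uv; apply/asboolP; have := UD Uu Uv; rewrite addrA subrK.
Qed.
Canonical quotient_equiv := EquivRelPack quotient_rel_equiv.
Definition quotient_module := {eq_quot quotient_equiv}%qT.
HB.instance Definition _ := Choice.on quotient_module.
Local Notation pi := (\pi_{eq_quot quotient_equiv}%qT : V -> quotient_module).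

Local Open Scope quotient_scope.
Let piP u v : pi u = pi v <-> U (u - v).
Proof. by split=> [/eqmodP /asboolP|Uuv] //; apply/eqmodP/asboolP. Qed.
Let reprP u : U (repr (pi u) - u).
Proof. by apply/piP; rewrite reprK. Qed.
Let piW P : (forall u, P (pi u)) -> forall x : quotient_module, P x.
Proof. exact: quotW. Qed.
Let addq (x y : quotient_module) := pi (repr x + repr y).
Let oppq (x : quotient_module) := pi (- repr x).
Let scaleq a (x : quotient_module) := pi (a *: repr x).
Let piD u v : addq (pi u) (pi v) = pi (u + v).
Proof. by apply/piP; rewrite opprD addrACA; apply: UD; apply: reprP. Qed.
Let piN u : oppq (pi u) = pi (- u).
Proof. by apply/piP; rewrite -opprD; apply: UN. Qed.
Let piZ a u : scaleq a (pi u) = pi (a *: u).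
Proof. by apply/piP; rewrite -scalerBr; apply: UZ. Qed.
Let addqA : associative addq.
Proof. by elim/piW=> x; elim/piW=> y; elim/piW=> z; rewrite !piD addrA. Qed.
Let addqC : commutative addq.
Proof. by elim/piW=> x; elim/piW=> y; rewrite !piD addrC. Qed.
Let add0q : left_id (pi 0) addq.
Proof. by elim/piW=> x; rewrite !piD add0r. Qed.
Let addNq : left_inverse (pi 0) oppq addq.
Proof. by elim/piW=> x; rewrite piN !piD addNr. Qed.
HB.instance Definition _ := GRing.isZmodule.Build quotient_module addqA addqC add0q addNq.
Let piDE u v : pi u + pi v = pi (u + v). Proof. exact: piD. Qed.
Let scaleqA a b x : scaleq a (scaleq b x) = scaleq (a * b) x.
Proof. by elim/piW: x => x; rewrite !piZ scalerA. Qed.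
Let scale1q : left_id 1 scaleq.
Proof. by elim/piW=> x; rewrite piZ scale1r. Qed.
Let scaleqDr : right_distributive scaleq +%R.
Proof. by move=> a; elim/piW=> x; elim/piW=> y; rewrite piDE !piZ piDE scalerDr. Qed.
Let scaleqDl v : {morph scaleq^~ v : a b / a + b}.
Proof. by move=> a b; elim/piW: v => x; rewrite !piZ piDE scalerDl. Qed.
HB.instance Definition _ :=
  GRing.Zmodule_isLmodule.Build R quotient_module scaleqA scale1q scaleqDr scaleqDl.
Definition quotient_map (u : V) : quotient_module := pi u.
Lemma quotient_map_linear : linear quotient_map.
Proof. by move=> a u v; rewrite [LHS]/quotient_map -piD -piZ. Qed.
HB.instance Definition _ :=
  GRing.isLinear.Build R V quotient_module _ quotient_map quotient_map_linear.

Lemma quotient_map_surj x : exists u, quotient_map u = x.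
Proof. by elim/piW: x => u; exists u. Qed.
Lemma quotient_map_eq0 u : quotient_map u = 0 <-> U u.
Proof. by rewrite -[u in U u]subr0 -piP. Qed.

End Quotients.

(** Graphs of maps into V/U, pulled back to R x V, are the submodules G whose
    fibre over 0 is U. *)
Lemma baer_quotient (R : comNzRingType) (V : lmodType R) (U : set V)
    (Usub : submodule U) :
  (forall G : set (R^o * V), submodule G -> (forall y, G (0, y) <-> U y) ->
     exists z, forall r y, G (r, y) -> U (y - r *: z)) ->
  baer (quotient_module Usub).
Proof.
move=> UB H [[H0 HD] HI].
pose G : set (R^o * V) := [set p | H (p.1, quotient_map Usub p.2)].
have [||z Gz] := UB G.
- split=> [|a u v Gu Gv]; first by rewrite /G /= linear0.
  by rewrite /G /= linearP; apply: HD a (_, _) (_, _) Gu Gv.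
- move=> y; rewrite /G /=; split=> [/HI/quotient_map_eq0 //|Uy].
  by have /(_ Usub) -> := iffRL (quotient_map_eq0 _ _) Uy.
exists (quotient_map Usub z) => r x Hrx.
have [y yx] := quotient_map_surj x.
have /Gz : G (r, y) by rewrite /G /= yx.
by move/(quotient_map_eq0 Usub); rewrite linearB linearZ /= yx => /eqP; rewrite subr_eq0 => /eqP.
Qed.

(** * The resolution of a domain by its fraction field

    A ring L with an injective map psi to a field K is resolved by
    0 -> L -> K -> K/psi(L) -> 0. *)

Section FractionModule.
Variables (L : comNzRingType) (K : fieldType) (psi : {rmorphism L -> K}).

(** K as an L-module through psi; psi is an argument of the type so that the
    action can be recovered from it. *)
Definition fraction_module & {rmorphism L -> K} : Type := K.
Local Notation V := (fraction_module psi).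
HB.instance Definition _ := GRing.Zmodule.on V.
Definition fraction_scale (a : L) (z : V) : V := psi a * (z : K).
Lemma fraction_scaleA a b z :
  fraction_scale a (fraction_scale b z) = fraction_scale (a * b) z.
Proof. by rewrite /fraction_scale rmorphM mulrA. Qed.
Lemma fraction_scale1 : left_id 1 fraction_scale.
Proof. by move=> z; rewrite /fraction_scale rmorph1 mul1r. Qed.
Lemma fraction_scaleDr : right_distributive fraction_scale +%R.
Proof. by move=> a y z; apply: mulrDr. Qed.
Lemma fraction_scaleDl z : {morph fraction_scale^~ z : a b / a + b}.
Proof. by move=> a b; rewrite /fraction_scale rmorphD; apply: mulrDl. Qed.
HB.instance Definition _ := GRing.Zmodule_isLmodule.Build L V
  fraction_scaleA fraction_scale1 fraction_scaleDr fraction_scaleDl.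

Hypothesis psi_inj : injective psi.

(** If a map sends a nonzero a to w, then it is multiplication by w/a, because
    K is torsion-free and divisible. *)
Lemma baer_fraction_module : baer V.
Proof.
move=> G GL; have [[G0 GD] GI] := GL.
have [[a [w [a0 Gaw]]]|noa] := pselect (exists a w, a != 0 /\ G (a, w)); last first.
  exists 0 => r y Gry; have [r0|r0] := eqVneq r 0.
    by rewrite scaler0; apply: GI; rewrite -r0.
  by case: noa; exists r, y.
have pa0 : psi a != 0 by rewrite -(rmorph0 psi) (inj_eq psi_inj).
exists ((w : K) / psi a) => r y Gry.
have GZ c p : G p -> G (c *: p) by move=> Gp; have := GD c _ _ Gp G0; rewrite addr0.
have e : psi a * (y : K) = psi r * (w : K).
  apply: (linear_graph_inj GL (GZ a _ Gry)).
  by have := GZ r _ Gaw; congr (G (_, _)); apply: mulrC.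
change ((y : K) = psi r * ((w : K) / psi a)).
by rewrite mulrA -e mulrAC divff ?mul1r.
Qed.

Lemma range_submodule : submodule (range psi : set V).
Proof.
split; first by exists 0; rewrite ?rmorph0.
by move=> a _ _ [b _ <-] [c _ <-]; exists (a * b + c); rewrite ?rmorphD ?rmorphM.
Qed.

Definition fraction_embedding : L^o -> V := psi.
Lemma fraction_embedding_linear : linear fraction_embedding.
Proof. by move=> a u v; rewrite /fraction_embedding rmorphD rmorphM. Qed.
HB.instance Definition _ :=
  GRing.isLinear.Build L L^o V _ fraction_embedding fraction_embedding_linear.

Definition fraction_resolution (i : nat) : lmodType L :=
  match i with
  | 0 => V
  | 1 => quotient_module range_submodule
  | _ => 'rV[L]_0
  end%N.
Definition fraction_differential (i : nat) :
  {linear fraction_resolution i -> fraction_resolution i.+1} :=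
  match i with
  | 0 => quotient_map range_submodule
  | _ => \0
  end%N.

(** Baer's criterion for K/psi(L) in terms of K: the relations G are the maps
    from an ideal of L to K/psi(L), and z represents an element of K/psi(L) that
    induces G. *)
Definition fraction_extension :=
  forall G : set (L * K),
    (forall a x y x' y', G (x, y) -> G (x', y') ->
       G (a * x + x', psi a * y + y')) ->
    (forall y, G (0, y) <-> range psi y) ->
    exists z, forall x y, G (x, y) -> range psi (y - psi x * z).

Lemma fraction_injective_dimension :
  fraction_extension -> injective_dimension_le L^o 1.
Proof.
move=> H.
have rV0 (u : 'rV[L]_0) : u = 0 by apply/rowP=> -[].
exists fraction_resolution, fraction_embedding, fraction_differential; split=> //.
- move=> y; split=> [/(quotient_map_eq0 range_submodule)[x _ <-]|[x <-]]; first by exists x.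
  by apply/(quotient_map_eq0 range_submodule); exists x.
- move=> [|i] y; split=> [_|_]; [exact: quotient_map_surj|exact: rV0| |exact: rV0].
  by exists 0; rewrite linear0 [RHS]rV0.
- move=> [|[|i]]; first exact/baer_injective/baer_fraction_module.
    apply/baer_injective/baer_quotient => G [_ GD] G0.
    by have [a x y x' y' Gxy|//|z zP] := H G; [apply: GD Gxy|exists z].
  by move=> A B j f _; exists \0 => x; rewrite [RHS]rV0.
- by move=> [|[|i]] // _; apply: rV0.
Qed.
End FractionModule.

(** * Localizations of a domain inside a field *)

(** Any localization of a domain R maps to every field that contains R, by
    a/s |-> a/s; the choice of the fraction does not matter because R is a
    domain. *)
Lemma localization_embedding (R : comNzRingType) (K : fieldType)
    (iota : {rmorphism R -> K}) (P : set R) (L : comUnitRingType)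
    (phi : {rmorphism R -> L}) :
  injective iota -> P 0 -> is_localization_at P phi ->
  exists2 psi : {rmorphism L -> K}, injective psi & forall a, psi (phi a) = iota a.
Proof.
move=> iota_inj P0 [phiU phiF phi0].
have iota0 s : ~ P s -> iota s != 0.
  by move=> Ps; apply/eqP => s0; apply: Ps; rewrite (_ : s = 0) //; apply: iota_inj; rewrite rmorph0.
have phi_inj a : phi a = 0 -> a = 0.
  move=> /phi0[s Ps sa]; apply: iota_inj; apply: (mulfI (iota0 _ Ps)).
  by rewrite -rmorphM sa !rmorph0 mulr0.
have frac x : exists p : R * R, ~ P p.2 /\ phi p.2 * x = phi p.1.
  have [a [s [Ps ->]]] := phiF x; exists (a, s); split=> //=.
  by rewrite mulrC divrK //; apply: phiU.
pose num x := projT1 (cid (frac x)).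
have numP x : ~ P (num x).2 /\ phi (num x).2 * x = phi (num x).1.
  by rewrite /num; case: cid.
pose psi x := iota (num x).1 / iota (num x).2.
have psiE x a s : iota s != 0 -> phi s * x = phi a -> psi x = iota a / iota s.
  move=> s0 xa; have [/iota0 n0 xn] := numP x; apply/eqP.
  rewrite eqr_div // -!rmorphM; apply/eqP; congr (iota _); apply/eqP.
  rewrite -subr_eq0; apply/eqP/phi_inj.
  rewrite rmorphB !rmorphM -xn -xa; ring.
have psi_phi a : psi (phi a) = iota a.
  by rewrite (psiE _ a 1) ?rmorph1 ?divr1 ?mul1r ?oner_neq0.
have psiB : zmod_morphism psi.
  move=> x y; have [/iota0 x0 xE] := numP x; have [/iota0 y0 yE] := numP y.
  rewrite (psiE (x - y) ((num x).1 * (num y).2 - (num y).1 * (num x).2)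
    ((num x).2 * (num y).2)).
  - by rewrite rmorphB !rmorphM /psi; field; apply/andP.
  - by rewrite rmorphM mulf_neq0.
  - by rewrite rmorphB !rmorphM -xE -yE; ring.
have psiM : monoid_morphism psi.
  split; first by rewrite -(rmorph1 phi) psi_phi rmorph1.
  move=> x y; have [/iota0 x0 xE] := numP x; have [/iota0 y0 yE] := numP y.
  rewrite (psiE (x * y) ((num x).1 * (num y).1) ((num x).2 * (num y).2)).
  - by rewrite !rmorphM mulf_div.
  - by rewrite rmorphM mulf_neq0.
  - by rewrite !rmorphM -xE -yE mulrACA.
pose psiz := GRing.isZmodMorphism.Build _ _ psi psiB.
pose psim := GRing.isMonoidMorphism.Build _ _ psi psiM.
pose psi' : {rmorphism L -> K} := HB.pack psi psiz psim.
exists psi' => // x y xy; apply/eqP; rewrite -subr_eq0; apply/eqP.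
have {xy} : psi' (x - y) = 0 by rewrite rmorphB xy subrr.
have [Px xyE] := numP (x - y) => /eqP.
rewrite /= /psi mulf_eq0 invr_eq0 (negPf (iota0 _ Px)) orbF => /eqP n0.
apply: (mulrI (phiU _ Px)); rewrite xyE mulr0.
by rewrite (_ : (num (x - y)).1 = 0) ?rmorph0 //; apply: iota_inj; rewrite rmorph0.
Qed.

(** * Polynomials supported on a numerical semigroup *)

Section SemigroupRing.
Variables (k : fieldType) (S : natSubmonoid).
Local Notation R := (semigroup_ring k S).
Local Notation RS := (@semigroup_poly k S).

Lemma semigroup_polyP (p : {poly k}) :
  reflect (forall i, p`_i != 0 -> submonoid_set S i) (p \in RS).
Proof. exact: asboolP. Qed.

Lemma semigroup_polyZ a p : p \in RS -> a *: p \in RS.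
Proof.
move=> /semigroup_polyP Sp; apply/semigroup_polyP=> i.
by rewrite coefZ mulf_eq0 negb_or => /andP[_ /Sp].
Qed.

Lemma semigroup_polyXn n : submonoid_set S n -> 'X^n \in RS.
Proof.
by move=> Sn; apply/semigroup_polyP=> i; rewrite coefXn; have [->|] := eqVneq i n; rewrite ?eqxx.
Qed.

(** With a = a_0 (1 - r), the truncated geometric series in r inverts a up to
    r^n, which is divisible by t^n.  The series involves only products of a with
    itself, hence stays in k[S] if a does. *)
Lemma truncated_inverse (a : {poly k}) n : a`_0 != 0 ->
  exists h g, a * h = 1 - 'X^n * g /\ (a \in RS -> h \in RS).
Proof.
move=> a0; pose r := 1 - (a`_0)^-1 *: a.
have aE : a = a`_0 *: (1 - r) by rewrite opprB addrCA subrr addr0 scalerA divff ?scale1r.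
have r0 : r = 'X * drop_poly 1 r.
  apply/polyP=> -[|i]; rewrite coefXM ?coef_drop_poly ?addn1 //=.
  by rewrite coefB coefZ coef1 mulVf ?subrr.
exists ((a`_0)^-1 *: \sum_(i < n) r ^+ i), (drop_poly 1 r ^+ n); split.
  rewrite {1}aE -scalerAl -scalerAr scalerA divff // scale1r.
  by rewrite -[1 - r]opprB mulNr -subrX1 opprB {1}r0 exprMn.
move=> aS; apply/semigroup_polyZ/rpred_sum => i _; apply: rpredX.
by apply: rpredB; rewrite ?rpred1 ?semigroup_polyZ.
Qed.

Variable c : nat.
Hypothesis Sc : forall i, (c <= i)%N -> submonoid_set S i.

Lemma semigroup_poly_conductor n (p : {poly k}) : (c <= n)%N -> 'X^n * p \in RS.
Proof.
move=> cn; apply/semigroup_polyP=> i; rewrite coefXnM.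
by case: ltnP => [_|ni _]; [rewrite eqxx|apply: Sc; lia].
Qed.

(** Up to an element that is invertible at the origin, every nonzero polynomial
    divides a power of t.  The cofactor h is a multiple of a high power of t, so
    that its multiples all lie in k[S]. *)
Lemma unit_times_Xn (q : {poly k}) B : q != 0 ->
  exists N h u, [/\ forall p, p * h \in RS, u \in RS, u`_0 = 1, (B <= N)%N &
    q * h = 'X^N * u].
Proof.
move=> q0; have [v [q' + qE]] := multiplicity_XsubC q 0.
rewrite q0 /= rootE horner_coef0 => q'0.
have [h [g [q'h _]]] := truncated_inverse c.+1 q'0.
exists (v + (B + c))%N, ('X^(B + c) * h), (1 - 'X^(c.+1) * g).
split; last 1 first.
- by rewrite qE subr0 -q'h [in RHS]exprD; ring.
- by move=> p; rewrite mulrCA; apply: semigroup_poly_conductor; lia.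
- by apply: rpredB; rewrite ?rpred1 ?semigroup_poly_conductor.
- by rewrite coefB coef1 coefXnM /= subr0.
- by lia.
Qed.

End SemigroupRing.

(** The closure properties that make the complement of P a set of denominators. *)
Definition prime_subset (R : comNzRingType) (P : set R) :=
  [/\ ~ P 1, P 0 & forall a b, P (a * b) -> P a \/ P b].

(** The ideal generated by the t^s with s > 0 in S, the maximal ideal at
    the origin of the monomial curve. *)
Definition origin_ideal (k : fieldType) (S : natSubmonoid) : set (semigroup_ring k S) :=
  [set s : semigroup_ring k S | (val s)`_0 = 0].

Lemma origin_idealE (k : fieldType) (S : natSubmonoid) (s : semigroup_ring k S) :
  origin_ideal s = ((val s)`_0 = 0).
Proof. by []. Qed.

Lemma coef0_mul (k : fieldType) (p q : {poly k}) : (p * q)`_0 = p`_0 * q`_0.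
Proof. by rewrite coefM big_ord_recl big_ord0 addr0. Qed.

Lemma origin_ideal_prime (k : fieldType) (S : natSubmonoid) :
  prime_subset (@origin_ideal k S).
Proof.
split=> [||a b]; rewrite !origin_idealE.
- by rewrite rmorph1 coef1 => /eqP; rewrite oner_eq0.
- by rewrite rmorph0 coef0.
- move=> /eqP; rewrite rmorphM coef0_mul mulf_eq0.
  by case/orP=> /eqP; [left|right].
Qed.

Lemma origin_ideal_maximal (k : fieldType) (S : natSubmonoid) :
  maximal_ideal (@origin_ideal k S).
Proof.
have [M1 M0 _] := origin_ideal_prime k S.
split=> //.
  split=> // [x y|a x]; rewrite !origin_idealE.
    by rewrite rmorphD coefD => -> ->; rewrite addr0.
  by rewrite rmorphM coef0_mul => ->; rewrite mulr0.
move=> J [J0 JD JM] MJ J1; apply/seteqP; split=> // s Js; apply: contrapT => Ms.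
have s0 : (val s)`_0 != 0 by apply/eqP.
apply: J1; pose u : semigroup_ring k S :=
  SemigroupRing (semigroup_polyZ ((val s)`_0)^-1 (rpred1 (@semigroup_poly k S))).
rewrite -(subrK (u * s) 1); apply: JD; last exact: JM.
apply: MJ; rewrite origin_idealE rmorphB rmorphM rmorph1 /= -scalerAl mul1r.
by rewrite coefB coefZ coef1 mulVf // subrr.
Qed.

Lemma size_sub_lead (k : fieldType) (p q : {poly k}) :
  p != 0 -> size q = size p -> lead_coef q = lead_coef p ->
  (size (p - q)%R < size p)%N.
Proof.
move=> p0 qp lqp; have := size_poly_gt0 p; rewrite p0 => sp.
rewrite -(prednK sp) ltnS; apply/leq_sizeP => j; rewrite leq_eqVlt coefB => /predU1P[<-|lt_j].
  by move: lqp; rewrite !lead_coefE qp => ->; rewrite subrr.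
have pj : (size p <= j)%N by lia.
by rewrite !nth_default ?subrr ?qp.
Qed.

(** The degrees of the nonzero elements of an ideal I are stable under adding
    multiples of an e with t^e in k[S].  So finitely many elements of I generate
    it: one of least degree in each residue class modulo e for which there is
    one.  Subtracting monomial multiples of these lowers the degree of any
    element of I. *)
Lemma noetherian_semigroup_ring (k : fieldType) (S : natSubmonoid) (c : nat) :
  (forall i, (c <= i)%N -> submonoid_set S i) -> noetherian (semigroup_ring k S).
Proof.
move=> Sc I [I0 ID IM]; set R := semigroup_ring k S.
pose e := c.+1.
pose dg (f : R) := (size (val f)).-1.
pose good r (f : R) := [/\ I f, f != 0 & (dg f %% e)%N = r].
have /choice[gen genP] (r : nat) : exists g : R, I g /\
    forall f, good r f -> good r g /\ (dg g <= dg f)%N.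
  have [ex|nex] := pselect (exists d, `[< exists2 f, good r f & dg f = d >]); last first.
    by exists 0; split=> // f gf; case: nex; exists (dg f); apply/asboolP; exists f.
  case: (ex_minnP ex) => d /asboolP[g gg gd] dmin.
  exists g; split; first by case: gg.
  by move=> f gf; split=> //; rewrite gd; apply: dmin; apply/asboolP; exists f.
pose s := [seq gen r | r <- iota 0 e].
have ss : size s = e by rewrite size_map size_iota.
have sE (i : nat) : (i < e)%N -> s`_i = gen i.
  by move=> ie; rewrite (nth_map 0%N) ?size_iota // nth_iota.
exists s; apply/seteqP; split=> [f|_ [a ->]]; last first.
  elim/big_ind: _ => // i _; apply: IM; rewrite sE ?(leq_trans (ltn_ord i)) ?ss //.
  by have [] := genP i.
move: {-1}(size (val f)) (leqnn (size (val f))) => n.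
elim: n f => [|n IH] f fn If.
  exists (fun=> 0); rewrite big1 => [|i _]; last by rewrite mul0r.
  by apply: val_inj; apply/eqP; rewrite -size_poly_eq0 -leqn0.
have [->|f0] := eqVneq f 0.
  by exists (fun=> 0); rewrite big1 => // i _; rewrite mul0r.
have re : (dg f %% e < e)%N by rewrite ltn_mod.
set r := (dg f %% e)%N in re.
have [_ /(_ f)[//|[Ig g0 gr] gf]] := genP r.
set g := gen r in Ig g0 gr gf.
have [j jE] : exists j, (dg f = dg g + j * e)%N.
  exists ((dg f - dg g) %/ e)%N; rewrite divnK ?subnKC //.
  by rewrite -eqn_mod_dvd // gr.
have Sj : submonoid_set S (j * e)%N.
  case: j {jE} => [|j]; first by rewrite mul0n; case: (submonoidP S).
  by apply: Sc; rewrite /e mulSn; lia.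
have vf0 : val f != 0 by apply: contraNneq f0 => vf0; apply/eqP/val_inj.
have vg0 : val g != 0 by apply: contraNneq g0 => vg0; apply/eqP/val_inj.
have lg0 : lead_coef (val g) != 0 by rewrite lead_coef_eq0.
pose a := lead_coef (val f) / lead_coef (val g).
have a0 : a != 0 by rewrite mulf_neq0 ?invr_eq0 ?lead_coef_eq0.
pose m : R := SemigroupRing (semigroup_polyZ a (semigroup_polyXn k Sj)).
have vm : val m = a *: 'X^(j * e)%N by [].
have [||b bE] := IH (f - m * g).
- rewrite -ltnS (leq_trans _ fn) // (_ : val _ = val f - val m * val g) ?vm;
    last by rewrite rmorphB rmorphM.
  apply: size_sub_lead => //.
    rewrite -scalerAl size_scale // mulrC size_mulXn //.
    have pred_add u v w : (0 < u)%N -> (0 < v)%N -> u.-1 = (v.-1 + w)%N -> (w + v)%N = u by lia.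
    by apply: pred_add; rewrite ?size_poly_gt0.
  by rewrite lead_coefM lead_coefZ lead_coefXn mulr1 /a divfK.
- have -> : f - m * g = f + (- m) * g by rewrite mulNr.
  by apply: ID => //; apply: IM.
have rs : (r < size s)%N by rewrite ss.
exists (fun i => b i + (if i == Ordinal rs then m else 0)).
under eq_bigr do rewrite mulrDl; rewrite big_split /= -bE.
rewrite (bigD1 (Ordinal rs)) //= eqxx big1 => [|i /negPf ->]; last by rewrite mul0r.
by rewrite addr0 sE // subrK.
Qed.

(** * Maps from ideals to K/L *)

Local Notation "x %:F" := (@FracField.tofrac _ x) : ring_scope.

Lemma fraction_repr (D : idomainType) (z : {fraction D}) :
  exists p q, q != 0 /\ z = p%:F / q%:F.
Proof.
elim/quotW: z => x; exists (frac x).1, (frac x).2; split; first exact: denom_ratioP.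
have d0 : (frac x).2%:F != 0 :> {fraction D} by rewrite tofrac_eq0 denom_ratioP.
apply: (mulIf d0); rewrite divfK //.
rewrite -[LHS]/(FracField.mul _ _) !piE; apply/eqmodP.
rewrite /= FracField.equivfE /FracField.mulf.
by rewrite !numden_Ratio ?mulr1 ?oner_neq0 ?denom_ratioP // mulrC.
Qed.

(** The only ideals of a field are 0 and the field. *)
Lemma baer_field (k : fieldType) (E : lmodType k) : baer E.
Proof.
move=> G [[G0 GD] GI].
have [[a [y [a0 Gay]]]|noa] := pselect (exists a y, a != 0 /\ G (a, y)); last first.
  exists 0 => a y Gay; have [a0|a0] := eqVneq a 0.
    by rewrite scaler0; apply: GI; rewrite -a0.
  by case: noa; exists a, y.
exists (a^-1 *: y) => b u Gbu.
have := GD (- (b / a)) _ _ Gay Gbu.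
rewrite -[_ + _]/(- (b / a) * a + b, - (b / a) *: y + u).
rewrite mulNr divfK // addNr => /GI/eqP.
by rewrite scaleNr addrC subr_eq0 scalerA => /eqP.
Qed.

Section Extension.
Variables (L : comUnitRingType) (K : fieldType) (psi : {rmorphism L -> K}).

(** On a principal ideal (g), the map that sends g to w is multiplication by
    w/g. *)
Lemma fraction_extension_PID :
  (forall I : set L, ideal I -> exists2 g, I g & forall x, I x -> exists b, x = b * g) ->
  injective psi -> fraction_extension psi.
Proof.
move=> pid psi_inj G GD G0.
have G00 : G (0, 0) by apply/G0; exists 0; rewrite ?rmorph0.
have GM a x y : G (x, y) -> G (a * x, psi a * y).
  by move=> Gxy; have := GD a _ _ _ _ Gxy G00; rewrite !addr0.
have [|g [w Ggw] Ig] := pid [set x | exists y, G (x, y)].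
  split; first by exists 0.
    move=> x x' [y Gy] [y' Gy']; have := GD 1 _ _ _ _ Gy Gy'.
    by rewrite rmorph1 !mul1r; exists (y + y').
  by move=> a x [y /(GM a)]; exists (psi a * y).
exists (w / psi g) => x y Gxy; have [|b xE] := Ig x; first by exists y.
have Gy : range psi (y - psi b * w).
  apply/G0; have := GD (- b) _ _ _ _ Ggw Gxy.
  by rewrite rmorphN !mulNr -xE addNr addrC.
have [g0|g0] := eqVneq g 0.
  rewrite xE g0 mulr0 rmorph0 mul0r subr0.
  by apply/G0; have := Gxy; rewrite xE g0 mulr0.
suff -> : psi x * (w / psi g) = psi b * w by [].
by rewrite xE rmorphM -mulrA [psi g * _]mulrC divfK // -(rmorph0 psi) (inj_eq psi_inj).
Qed.

Lemma range_rmorphB u v : range psi u -> range psi v -> range psi (u - v).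
Proof. by move=> [x _ <-] [y _ <-]; exists (x - y); rewrite ?rmorphB. Qed.
Lemma range_rmorphD u v : range psi u -> range psi v -> range psi (u + v).
Proof. by move=> [x _ <-] [y _ <-]; exists (x + y); rewrite ?rmorphD. Qed.
Lemma range_rmorphM u v : range psi u -> range psi v -> range psi (u * v).
Proof. by move=> [x _ <-] [y _ <-]; exists (x * y); rewrite ?rmorphM. Qed.

End Extension.

(** Below, iota embeds k[t] in its fraction field K, and psi identifies the
    localization L of k[S] at M with a subring of K. *)

Section Localization.
Variables (k : fieldType) (S : natSubmonoid) (M : set (semigroup_ring k S)).
Variables (L : comUnitRingType) (phi : {rmorphism semigroup_ring k S -> L}).
Variables (K : fieldType) (iota : {rmorphism {poly k} -> K}).
Hypothesis iota_inj : injective iota.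
Hypothesis iota_frac : forall w, exists p q, q != 0 /\ w = iota p / iota q.
Variable psi : {rmorphism L -> K}.
Hypothesis psi_inj : injective psi.
Hypothesis psi_phi : forall a, psi (phi a) = iota (val a).
Hypothesis loc : is_localization_at M phi.
Local Notation RS := (@semigroup_poly k S).

Let phiU s : ~ M s -> phi s \is a GRing.unit. Proof. by case: loc => U _ _; apply: U. Qed.
Let phiF x : exists a s, ~ M s /\ phi s * x = phi a.
Proof.
case: loc => _ + _ => /(_ x)[a [s [Ms ->]]]; exists a, s; split=> //.
by rewrite mulrC divrK ?phiU.
Qed.
Let iota_eq0 p : (iota p == 0) = (p == 0).
Proof. by rewrite -(rmorph0 iota) (inj_eq iota_inj). Qed.
Let range_poly p : p \in RS -> range psi (iota p).
Proof. by move=> pS; exists (phi (SemigroupRing pS)); rewrite ?psi_phi. Qed.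

(** Every ideal of a localization of k[S] is generated by its elements in k[S],
    hence by those in k[t] if L contains k[t]; one of least degree generates. *)
Lemma overring_PID : (forall p : {poly k}, range psi (iota p)) ->
  forall I : set L, ideal I -> exists2 g, I g & forall x, I x -> exists b, x = b * g.
Proof.
move=> polyL I [I0 ID IM].
have [ex|nex] := pselect (exists d,
    `[< exists g p, [/\ I g, psi g = iota p, p != 0 & size p = d] >]); last first.
  exists 0 => // x Ix; exists 0; rewrite mul0r.
  have [a [s [Ms xE]]] := phiF x.
  apply: (mulrI (phiU Ms)); rewrite mulr0 xE; apply: psi_inj.
  rewrite rmorph0 psi_phi; have [->|a0] := eqVneq (val a) 0; first exact: rmorph0.
  case: nex; exists (size (val a)); apply/asboolP; exists (phi a), (val a).
  by split=> //; rewrite -xE; apply: IM.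
case: (ex_minnP ex) => d /asboolP[g [p [Ig gp p0 pd]]] dmin.
exists g => // x Ix; have [a [s [Ms xE]]] := phiF x.
have [b _ bE] := polyL (val a %/ p).
have modE : psi (phi a - b * g) = iota (val a %% p).
  by rewrite rmorphB rmorphM psi_phi bE gp -rmorphM -rmorphB {1}(divp_eq (val a) p) addrC addKr.
have mod0 : val a %% p = 0.
  apply/eqP; apply: contraT => m0; have := ltn_modp (val a) p; rewrite p0 ltnNge pd.
  rewrite dmin //; apply/asboolP; exists (phi a - b * g), (val a %% p); split=> //.
  rewrite addrC -mulNr; apply: ID; first exact: IM.
  by rewrite -xE; apply: IM.
exists ((phi s)^-1 * b); rewrite -mulrA; apply: (mulrI (phiU Ms)).
rewrite mulVKr ?phiU // xE; apply/eqP; rewrite -subr_eq0; apply/eqP/psi_inj.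
by rewrite modE mod0 !rmorph0.
Qed.

(** If s is divisible by t in k[t] and s^-1 is in L, then p = (p s^c)/s^c for
    every polynomial p, and p s^c lies in k[S] once c reaches the conductor. *)
Lemma overring_of_unit (c : nat) (s : semigroup_ring k S) :
  (forall i, (c <= i)%N -> submonoid_set S i) ->
  (val s)`_0 = 0 -> ~ M s -> forall p : {poly k}, range psi (iota p).
Proof.
move=> Sc s0 Ms p.
have sE : val s = 'X * drop_poly 1 (val s).
  by apply/polyP=> -[|i]; rewrite coefXM ?coef_drop_poly ?addn1.
have pS : p * val s ^+ c \in RS.
  by rewrite sE exprMn mulrCA; apply: (semigroup_poly_conductor Sc).
exists (phi (SemigroupRing pS) / phi s ^+ c) => //.
rewrite rmorphM rmorphV ?unitrX ?phiU // rmorphXn !psi_phi /= rmorphM rmorphXn mulfK //.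
rewrite -rmorphXn iota_eq0 expf_neq0 //; apply/eqP => vs0.
have := phiU Ms; rewrite (_ : s = 0) ?rmorph0 ?unitr0 //; exact: val_inj.
Qed.

(** ** The localization at the origin of a symmetric semigroup ring *)

Variable F : nat.
Hypothesis SF : forall i, (F < i)%N -> submonoid_set S i.
Hypothesis Ssym : forall i, (i <= F)%N -> submonoid_set S i <-> ~ submonoid_set S (F - i)%N.
Hypothesis M_origin : forall s, ~ M s <-> (val s)`_0 != 0.

Let SFn : ~ submonoid_set S F.
Proof. by move/(iffLR (Ssym (leqnn F))); rewrite subnn; apply; case: (submonoidP S). Qed.
Let SD i j : submonoid_set S i -> submonoid_set S j -> submonoid_set S (i + j)%N.
Proof. by case: (submonoidP S) => _; apply. Qed.

Let T n (Sn : submonoid_set S n) : semigroup_ring k S :=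
  SemigroupRing (semigroup_polyXn k Sn).
Let psiT n (Sn : submonoid_set S n) : psi (phi (T Sn)) = iota 'X^n.
Proof. exact: psi_phi. Qed.
Let unit_origin (u : {poly k}) (uS : u \in RS) :
  u`_0 != 0 -> phi (SemigroupRing uS) \is a GRing.unit.
Proof. by move=> u0; apply/phiU/M_origin. Qed.

Lemma origin_clear_denominator w :
  exists N (SN : submonoid_set S N), range psi (psi (phi (T SN)) * w).
Proof.
have [p [q [q0 ->]]] := iota_frac w.
have [N [h [u [hS uS u0 FN qh]]]] := unit_times_Xn SF F.+1 q0.
have SN := SF FN; exists N, SN; exists (phi (SemigroupRing (hS p)) / phi (SemigroupRing uS)) => //.
have uU : phi (SemigroupRing uS) \is a GRing.unit by apply: unit_origin; rewrite u0 oner_neq0.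
have uK : iota u != 0.
  rewrite iota_eq0; apply: contraTneq uU => u00.
  by rewrite (_ : SemigroupRing uS = 0) ?rmorph0 ?unitr0 //; apply: val_inj.
rewrite rmorphM rmorphV // !psi_phi /= mulrA; apply/eqP.
rewrite eqr_div ?uK ?iota_eq0 // -!(rmorphM iota); apply/eqP; congr (iota _).
by transitivity (p * (q * h)); [|rewrite qh]; ring.
Qed.

Lemma origin_conductor_multiple x : x != 0 ->
  exists N (SN : submonoid_set S N), (F < N)%N /\ exists b, phi (T SN) = b * x.
Proof.
move=> x0; have [a [s [Ms xE]]] := phiF x.
have a0 : val a != 0.
  apply: contraNneq x0 => a0; apply/eqP/(mulrI (phiU Ms)).
  by rewrite xE mulr0 (_ : a = 0) ?rmorph0 //; apply: val_inj.
have [N [h [u [hS uS u0 FN ah]]]] := unit_times_Xn SF F.+1 a0.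
have SN := SF FN; exists N, SN; split=> //.
have h1 : h \in RS by rewrite -[h]mul1r.
have uU : phi (SemigroupRing uS) \is a GRing.unit by apply: unit_origin; rewrite u0 oner_neq0.
exists (phi (SemigroupRing h1) * phi s / phi (SemigroupRing uS)).
rewrite mulrAC; apply: (canRL (mulrK uU)); rewrite -mulrA xE -!(rmorphM phi); congr (phi _).
by apply: val_inj; rewrite !rmorphM /= -ah mulrC.
Qed.

(** Elements of L have power series supported on S, and F is a gap: so an
    element of t^c L has no term of degree c + F. *)
Lemma origin_socle_coef c (Sc : submonoid_set S c) (r : {poly k}) : r \in RS ->
  range psi (iota r / iota 'X^c) -> r`_(c + F) = 0.
Proof.
move=> rS [x _ xr]; have [b [s [/M_origin s0 xE]]] := phiF x.
have e : val s * r = 'X^c * val b.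
  apply/eqP; rewrite -(inj_eq iota_inj) !rmorphM -!psi_phi -xE rmorphM xr mulrCA.
  by rewrite psi_phi [iota _ / _]mulrC mulVKf // iota_eq0 monic_neq0 ?monicXn.
have [h [g [sh hS]]] := truncated_inverse S (c + F).+1 s0.
have hR : h \in RS by apply/hS/semigroup_ringP.
have -> : r = 'X^c * (val b * h) + 'X^((c + F).+1) * (g * r).
  rewrite mulrA -e -[RHS]opprK; apply: (canRL opprK).
  have : val s * h * r = (1 - 'X^((c + F).+1) * g) * r by rewrite sh.
  by move=> E; rewrite [val s * r * h]mulrAC E; ring.
rewrite coefD !coefXnM ltnS leqnn ltnNge leq_addr /= addKn addr0.
have /semigroup_polyP bS : val b * h \in RS by apply: rpredM => //; apply: semigroup_ringP.
by apply/eqP; apply: contraT => /bS/SFn.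
Qed.

(** The perfect pairing: on k[S]/t^c k[S], the functional that takes the
    coefficient of t^(c+F) pairs t^i with t^(c+F-i).  Here i and c+F-i are
    both in S and both outside c+S exactly when i is in S and not in c+S,
    because S is symmetric. *)
Lemma origin_extension_conductor (G : set (L * K)) c (Sc : submonoid_set S c) :
  (forall a x y x' y', G (x, y) -> G (x', y') -> G (a * x + x', psi a * y + y')) ->
  (forall y, G (0, y) <-> range psi y) ->
  (F < c)%N -> G (phi (T Sc), 0) ->
  exists z, forall x y, G (x, y) -> range psi (y - psi x * z).
Proof.
move=> GD G0 Fc GT.
have G00 : G (0, 0) by apply/G0; exists 0; rewrite ?rmorph0.
have GM a x y : G (x, y) -> G (a * x, psi a * y).
  by move=> Gxy; have := GD a _ _ _ _ Gxy G00; rewrite !addr0.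
have GA x y u : G (x, y) -> range psi u -> G (x, y + u).
  by move=> Gxy /G0 Gu; have := GD 1 _ _ _ _ Gxy Gu; rewrite rmorph1 !mul1r addr0.
have Xc0 : iota 'X^c != 0 by rewrite iota_eq0 monic_neq0 ?monicXn.
pose cst a : semigroup_ring k S := SemigroupRing (semigroup_polyZ a (rpred1 RS)).
have psi_cst a p : psi (phi (cst a)) * iota p = iota (a *: p).
  by rewrite psi_phi -rmorphM /= -scalerAl mul1r.
have val_lin b (a r : semigroup_ring k S) : val (cst b * a + r) = b *: val a + val r.
  by rewrite rmorphD rmorphM /= -scalerAl mul1r.
(* A value of G on k[S] has the form r/t^c modulo L with r in k[S], since t^c
   kills it; the functional takes the coefficient of t^(c+F) in r. *)
pose H : set ({poly k} * k^o) := [set p | exists a r : semigroup_ring k S,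
  [/\ p.1 = val a, G (phi a, iota (val r) / iota 'X^c) & p.2 = (val r)`_(c + F)]].
have HL : linear_graph H.
  split; first split.
  - by exists 0, 0; split=> //; rewrite ?rmorph0 ?mul0r // coef0.
  - move=> b u v [a [r [ua Gar ur]]] [a' [r' [va' Gar' vr']]].
    exists (cst b * a + a'), (cst b * r + r'); split.
    + by rewrite val_lin -ua -va'.
    + have := GD (phi (cst b)) _ _ _ _ Gar Gar'.
      rewrite -!rmorphM -rmorphD; congr (G (_, _)).
      by rewrite mulrA psi_cst -mulrDl -rmorphD val_lin.
    + by rewrite val_lin coefD coefZ -ur -vr'.
  - move=> y [a [r [/= a0 Gar ->]]]; apply: (origin_socle_coef Sc (semigroup_ringP r)).
    by apply/G0; move: Gar; rewrite (_ : a = 0) ?rmorph0 //; apply: val_inj.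
have [g gH] := linear_graph_extend (@baer_field k k^o) HL.
(* g vanishes on t^c k[S], since G does. *)
have g0 n : submonoid_set S (n - c)%N -> (c <= n)%N -> g 'X^n = 0.
  move=> Snc cn; apply: gH; exists (T Snc * T Sc), 0; split.
  - by rewrite rmorphM /= -exprD subnK.
  - by have := GM (phi (T Snc)) _ _ GT; rewrite mulr0 !rmorph0 mul0r rmorphM.
  - by rewrite coef0.
(* The element that represents g for the pairing. *)
pose w := \poly_(i < (c + F).+1)
  (if `[< submonoid_set S (c + F - i)%N >] then g 'X^(c + F - i) : k else 0).
have wS : w \in RS.
  apply/semigroup_polyP=> i; rewrite coef_poly; case: ltnP => [iF|]; last by rewrite eqxx.
  case: asboolP => [Sd|]; last by rewrite eqxx.
  move=> gi; apply: contrapT => Si; move/eqP: gi; apply.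
  have iF' : (i <= F)%N by rewrite leqNgt; apply/negP => /SF.
  apply: g0; last by lia.
  rewrite (_ : (c + F - i - c = F - i)%N); last by lia.
  by apply/(Ssym (leq_subr i F)); rewrite subKn.
exists (iota w / iota 'X^c).
(* It is enough to treat values on k[S] that are represented by some r/t^c with
   r in k[S]: every element of L is a unit times one of k[S], and t^c times a
   value lies in L = k[S] + t^c L. *)
suff main (a r : semigroup_ring k S) : G (phi a, iota (val r) / iota 'X^c) ->
    range psi (iota (val r) / iota 'X^c - iota (val a) * (iota w / iota 'X^c)).
  move=> x y Gxy; have [a [s [Ms xE]]] := phiF x.
  have Ga : G (phi a, psi (phi s) * y) by rewrite -xE; apply: GM.
  set Y := psi (phi s) * y in Ga.
  have [x' _ x'E] : range psi (iota 'X^c * Y).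
    apply/G0; have := GD (- phi a) _ _ _ _ GT (GM (phi (T Sc)) _ _ Ga).
    by rewrite mulr0 add0r psiT mulNr mulrC addNr.
  have [b [s' [/M_origin s'0 x'b]]] := phiF x'.
  have [h [q [s'h hS]]] := truncated_inverse S (c + F).+1 s'0.
  have hR : h \in RS by apply/hS/semigroup_ringP.
  pose r := b * SemigroupRing hR.
  have Yr : range psi (Y - iota (val r) / iota 'X^c).
    have -> : Y - iota (val r) / iota 'X^c = psi x' * iota ('X^(F.+1) * q).
      apply: (mulfI Xc0); rewrite mulrBr -x'E [iota 'X^c * (_ / _)]mulrC divfK //.
      have -> : iota (val r) = psi x' * iota (1 - 'X^((c + F).+1) * q).
        by rewrite -s'h !rmorphM /= -!psi_phi -x'b rmorphM mulrCA mulrA.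
      rewrite -addnS exprD rmorphB !rmorphM rmorph1; ring.
    apply: range_rmorphM; first by exists x'.
    by apply: range_poly; apply: (semigroup_poly_conductor SF).
  have /main mainr : G (phi a, iota (val r) / iota 'X^c).
    have -> : iota (val r) / iota 'X^c = Y + (0 - (Y - iota (val r) / iota 'X^c)).
      by rewrite sub0r opprB addrCA subrr addr0.
    by apply: GA => //; apply: range_rmorphB => //; exists 0; rewrite ?rmorph0.
  have [v _ vE] := range_rmorphD Yr mainr.
  exists ((phi s)^-1 * v) => //.
  have s0 : psi (phi s) != 0 by rewrite -unitfE rmorph_unit ?phiU.
  rewrite rmorphM rmorphV ?phiU // vE addrA subrK mulrBr mulKf //.
  by rewrite -psi_phi -xE rmorphM -mulrA mulKf.
move=> Gar; pose d := val r - val a * w.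
suff dE : d = 'X^c * drop_poly c d /\ drop_poly c d \in RS.
  have -> : iota (val r) / iota 'X^c - iota (val a) * (iota w / iota 'X^c) =
            iota (drop_poly c d).
    rewrite mulrA -mulrBl -rmorphM -rmorphB -/d {1}(proj1 dE) rmorphM.
    by rewrite mulrC mulrA mulVf ?mul1r.
  exact: range_poly (proj2 dE).
(* Pairing with t^(c+F-j) isolates the coefficient of t^j. *)
have d0 j : submonoid_set S (c + F - j)%N -> (j <= c + F)%N -> d`_j = 0.
  move=> Sn jcF; set n := (c + F - j)%N in Sn.
  have gE : g ('X^n * val a) = (val r)`_j.
    apply: gH; exists (T Sn * a), (T Sn * r); split; rewrite ?rmorphM //=.
      by have := GM (phi (T Sn)) _ _ Gar; rewrite psiT mulrA -rmorphM.
    by rewrite coefXnM; case: ltnP; [lia|move=> _; congr (_`_ _); lia].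
  rewrite coefB -gE -[val a]coefK poly_def mulr_suml mulr_sumr coef_sum linear_sum /=.
  rewrite -sumrB; apply: big1 => i _.
  rewrite -scalerAl -scalerAr coefZ linearZ /= coefXnM -exprD -mulrBr.
  have [->|/(elimT (semigroup_polyP _ _) (semigroup_ringP a)) Si] :=
    eqVneq (val a)`_i 0; first by rewrite mul0r.
  apply/eqP; rewrite mulf_eq0 subr_eq0; apply/orP; right; apply/eqP.
  case: ltnP => ij.
    by apply: g0; [apply: SF|]; lia.
  rewrite coef_poly (_ : (j - i < (c + F).+1)%N); last by lia.
  rewrite (_ : (c + F - (j - i) = n + i)%N); last by lia.
  by case: asboolP => // -[]; apply: SD.
(* By symmetry the coefficients shown to vanish are those outside c + S. *)
split.
  apply/polyP=> j; rewrite coefXnM coef_drop_poly; case: ltnP => jc; last by rewrite subnK.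
  by apply: d0; [apply: SF|]; lia.
apply/semigroup_polyP=> j; rewrite coef_drop_poly => dj; apply: contrapT => Sj.
have jF : (j <= F)%N by rewrite leqNgt; apply/negP => /SF.
move/eqP: dj; apply; apply: d0; last by lia.
rewrite (_ : (c + F - (j + c) = F - j)%N); last by lia.
by apply/(Ssym (leq_subr j F)); rewrite subKn.
Qed.

(** A nonzero ideal contains a power of t, and a higher power of t clears the
    denominator of its value. *)
Lemma origin_extension : fraction_extension psi.
Proof.
move=> G GD G0.
have G00 : G (0, 0) by apply/G0; exists 0; rewrite ?rmorph0.
have GM a x y : G (x, y) -> G (a * x, psi a * y).
  by move=> Gxy; have := GD a _ _ _ _ Gxy G00; rewrite !addr0.
have [[x [y [x0 Gxy]]]|no] := pselect (exists x y, x != 0 /\ G (x, y)); last first.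
  exists 0 => x y Gxy; rewrite mulr0 subr0; apply/G0.
  by have [<-//|x0] := eqVneq x 0; case: no; exists x, y.
have [N [SN [FN [b bE]]]] := origin_conductor_multiple x0.
have [N' [SN' SN'y]] := origin_clear_denominator (psi b * y).
have GT := GM (phi (T SN')) _ _ (GM b _ _ Gxy); rewrite -bE in GT.
apply: (@origin_extension_conductor G _ (SD SN' SN)) => //; first by lia.
have := GD (- 1) _ _ _ _ (iffRL (G0 _) SN'y) GT.
rewrite mulr0 add0r rmorphN1 mulN1r addNr; congr (G (_, _)).
by rewrite -rmorphM; congr (phi _); apply: val_inj; rewrite rmorphM /= -exprD.
Qed.
End Localization.

(** The standard fact that symmetric semigroups have Gorenstein rings; the
    injective dimension is at most 1 because the ring has dimension 1. *)
Theorem symmetric_gorenstein (k : fieldType) (S : natSubmonoid) (F : nat) :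
  (forall i, (F < i)%N -> submonoid_set S i) ->
  (forall i, (i <= F)%N -> submonoid_set S i <-> ~ submonoid_set S (F - i)%N) ->
  gorenstein_semigroup k S.
Proof.
move=> SF Ssym; split; first exact: (noetherian_semigroup_ring SF).
move=> M L phi [[M0 MD MM] M1 _] loc; exists 1%N.
pose K := {fraction {poly k}}.
pose iota : {rmorphism {poly k} -> K} := @FracField.tofrac {poly k}.
have iota_inj : injective iota.
  by move=> p q /eqP; rewrite tofrac_eq => /eqP.
pose rho : {rmorphism semigroup_ring k S -> K} := iota \o val.
have rho_inj : injective rho by move=> a b /iota_inj/val_inj.
have [psi psi_inj psi_phi] := localization_embedding rho_inj M0 loc.
have iota_frac w : exists p q, q != 0 /\ w = iota p / iota q := fraction_repr w.
apply: (@fraction_injective_dimension _ _ psi psi_inj).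
have [[s [s0 Ms]]|noS] := pselect (exists s : semigroup_ring k S, (val s)`_0 = 0 /\ ~ M s).
  apply: fraction_extension_PID => //; apply: (overring_PID psi_inj psi_phi loc).
  exact: (overring_of_unit iota_inj psi_phi loc SF s0).
have ME : M = @origin_ideal k S.
  have [_ _ Mmax] := origin_ideal_maximal k S; apply: Mmax => // s s0.
  by apply: contrapT => Ms; apply: noS; exists s.
apply: (origin_extension iota_inj iota_frac psi_phi loc SF Ssym) => s; rewrite ME.
by split=> /eqP.
Qed.

(** * Finite injective dimension and the socle *)

(** Every linear map from the ideal J to C is multiplication by an element of C.
    For an ideal J this says Ext^1(R/J, C) = 0. *)
Definition extends (R : comNzRingType) (E : lmodType R) (C : set E) (J : set R) :=
  forall G : set (R^o * E), linear_graph G ->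
    (forall r, J r <-> exists y, G (r, y)) -> (forall r y, G (r, y) -> C y) ->
    exists2 z, C z & forall r y, G (r, y) -> y = r *: z.

Lemma extends_setT (R : comNzRingType) (E : lmodType R) (C : set E) :
  extends C [set: R].
Proof.
move=> G GL GT GC; have [z Gz] := iffLR (GT 1) I; exists z; first exact: GC Gz.
move=> r y Gry; apply: (linear_graph_inj GL Gry).
have [[G0 GD] _] := GL; have := GD r _ _ Gz G0.
by rewrite addr0; congr (G (_, _)); apply: mulr1.
Qed.

Section LocalRing.
Variables (L : comUnitRingType) (m : set L).
Hypothesis m_ideal : submodule (m : set L^o).
Hypothesis m_local : forall a, m a \/ a \is a GRing.unit.

(** The exact sequence Ext^1(L/(J+uL), C) -> Ext^1(L/J, C) -> Ext^1(L/m, C),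
    where (J+uL)/J is L/m or 0.  Given a map f on J, the map a |-> f(a u) on m
    is multiplication by some c; letting u go to c extends f to J + uL. *)
Lemma extends_step (E : lmodType L) (C : set E) (J : set L) (u : L) :
  submodule C -> submodule (J : set L^o) -> (forall a, m a -> J (a * u)) ->
  extends C m -> extends C [set j + b * u | j in J & b in setT] -> extends C J.
Proof.
move=> [C0 CD] [J0 JD] mu Cm.
have [Ju|Ju] := pselect (J u).
  suff -> : [set j + b * u | j in J & b in setT] = J by [].
  apply/seteqP; split=> [_ [j Jj [b _ <-]]|j Jj].
    by rewrite addrC; exact: JD.
  by exists j => //; exists 0; rewrite ?mul0r ?addr0.
move=> CJ G GL GJ GC; have [[G0 GD] GI] := GL.
pose G1 : set (L^o * E) := [set p | m p.1 /\ G (p.1 * u, p.2)].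
have [||a y [] _ /GC //|c Cc cP] := Cm G1.
- split=> [|y []]; last by rewrite mul0r => _ /GI.
  split=> [|a [b y] [b' y'] [mb Gb] [mb' Gb']].
    by split; [case: m_ideal|rewrite mul0r].
  split; first by case: m_ideal => _; apply.
  by have := GD a _ _ Gb Gb'; congr (G (_, _)); rewrite /= mulrDl -mulrA.
- move=> a; split=> [ma|[y []//]].
  by have [y Gy] := iffLR (GJ _) (mu _ ma); exists y.
have mG a : m a -> G (a * u, a *: c).
  move=> ma; have [y Gy] := iffLR (GJ _) (mu _ ma).
  by rewrite -(cP a y).
pose H : set (L^o * E) := [set p | exists j b y,
  [/\ G (j, y), p.1 = j + b * u & p.2 = y + b *: c]].
have [||_ _ [j [b [y [/= Gj _ ->]]]]|z Cz zP] := CJ H.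
- split=> [|_ [j [b [y [/= Gj /esym/eqP + ->]]]]].
    split=> [|a p q [j [b [y [Gj pE qE]]]] [j' [b' [y' [Gj' pE' qE']]]]].
      by exists 0, 0, 0; split; rewrite ?mul0r ?scale0r ?addr0.
    exists (a * j + j'), (a * b + b'), (a *: y + y'); split=> /=.
    + exact: GD a _ _ Gj Gj'.
    + by rewrite pE pE' [LHS]/(a * _ + _) mulrDr mulrDl mulrA addrACA.
    + by rewrite qE qE' scalerDr scalerDl scalerA addrACA.
  rewrite addr_eq0 => /eqP jE; have [mb|Ub] := m_local b.
    rewrite (linear_graph_inj GL Gj (_ : G (j, - (b *: c)))) ?addNr // jE.
    have := GD (-1) _ _ (mG _ mb) G0; rewrite addr0.
    by congr (G (_, _)); rewrite /= ?scaleN1r.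
  case: Ju; have -> : u = - b^-1 * j + 0 by rewrite jE mulrNN mulKr ?addr0.
  by apply: (JD _ _ 0) => //; apply/GJ; exists y.
- move=> r; split=> [[j /GJ[y Gj] [b _ <-]]|[_ [j [b [y [/= Gj -> _]]]]]].
    by exists (y + b *: c), j, b, y.
  by exists j; [apply/GJ; exists y|exists b].
- by rewrite addrC; apply: CD => //; apply: GC Gj.
by exists z => // r y Gr; apply: zP; exists r, 0, y; rewrite mul0r scale0r !addr0.
Qed.

Lemma extends_chain (E : lmodType L) (C : set E) (J : nat -> set L) (u : nat -> L) :
  submodule C -> (forall n, submodule (J n : set L^o)) -> J 0%N = [set: L] ->
  (forall n a, m a -> J n.+1 (a * u n)) ->
  (forall n, J n = [set j + b * u n | j in J n.+1 & b in setT]) ->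
  extends C m -> forall n, extends C (J n).
Proof.
move=> CS JS J0 mu JE Cm; elim=> [|n IH]; first by rewrite J0; apply: extends_setT.
by apply: (extends_step CS (JS _) (mu n) Cm); rewrite -JE.
Qed.

(** The element u spans a copy of the residue field L/m in L/xL. *)
Variables (x u : L).
Hypothesis u_socle : forall a, m a -> exists b, a * u = b * x.
Hypothesis u_nonzero : forall b, u <> b * x.
Local Notation J0 := [set a * x + b * u | a in setT & b in setT].

(** If m e goes to 0 under delta, then a x + b u |-> delta (b e) is well defined:
    a x + b u = 0 forces b into m, as u is not a multiple of x.  By hypothesis it
    is multiplication by some delta c. *)
Lemma extends_socle (E1 E2 : lmodType L) (delta : {linear E1 -> E2}) (e : E1) :
  extends (range delta) J0 -> (forall a, m a -> delta (a *: e) = 0) ->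
  exists c, delta (x *: c) = 0 /\ delta e = delta (u *: c).
Proof.
move=> CJ me.
pose H : set (L^o * E2) := [set p | exists a b,
  p.1 = a * x + b * u /\ p.2 = delta (b *: e)].
have [|||_ [c _ <-] cP] := CJ H.
- split=> [|_ [a [b [/= /esym/eqP + ->]]]].
    split=> [|l [_ _] [_ _] [a [b [/= -> ->]]] [a' [b' [/= -> ->]]]].
      by exists 0, 0; rewrite !mul0r scale0r addr0 linear0.
    exists (l * a + a'), (l * b + b'); split=> /=.
      by rewrite [LHS]/(l * _ + _) mulrDr !mulrDl !mulrA addrACA.
    by rewrite scalerDl -scalerA linearP.
  rewrite addrC addr_eq0 => /eqP bE; have [mb|Ub] := m_local b; first exact: me.
  by case: (u_nonzero (b := b^-1 * - a)); rewrite -mulrA mulNr -bE mulKr.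
- move=> r; split=> [[a _ [b _ <-]]|[_ [a [b [/= -> _]]]]].
    by exists (delta (b *: e)), a, b.
  by exists a => //; exists b.
- by move=> r _ [a [b [_ /= ->]]]; exists (b *: e).
exists c; split; rewrite linearZ /=.
  by rewrite -(cP x 0) //; exists 1, 0; rewrite mul1r mul0r addr0 scale0r linear0.
by rewrite -(cP u (delta e)) //; exists 0, 1; rewrite mul1r mul0r add0r scale1r.
Qed.

(** With C' the kernel and C the image of delta, this is the vanishing of
    Ext^1(L/m, C') in the exact sequence
    Ext^1(L/xL, C') -> Ext^1(L/m, C') -> Ext^2(L/(x,u), C') = Ext^1(L/(x,u), C)
    that comes from the embedding of L/m in L/xL as the span of u.  The first
    term vanishes because C' is divisible by x. *)
Lemma extends_kernel (E1 E2 : lmodType L) (delta : {linear E1 -> E2}) :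
  baer E1 -> (forall y, delta y = 0 -> exists2 y', delta y' = 0 & y = x *: y') ->
  extends (range delta) J0 -> extends [set y | delta y = 0] m.
Proof.
move=> E1B divx CJ G GL Gm GC.
have [e eP] := E1B G GL.
have [|c [xc uc]] := extends_socle (e := e) CJ.
  by move=> a /Gm[y Gy]; have := GC _ _ Gy; rewrite (eP _ _ Gy).
have [c' c'0 xc'] := divx _ xc.
exists (e - u *: (c - c')) => [|r y Gry].
  have uc'0 : delta (u *: c') = 0 by rewrite linearZ /= c'0 scaler0.
  by rewrite /= linearB scalerBr [delta (_ - _)]linearB uc uc'0 subr0 subrr.
have [|b ru] := u_socle (a := r); first by apply/Gm; exists y.
by rewrite scalerBr scalerA ru -scalerA scalerBr xc' subrr scaler0 subr0; apply: eP.
Qed.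

Hypothesis x_regular : forall a, a * x = 0 -> a = 0.
Hypothesis x_m : m x.

Lemma baer_divisible (E : lmodType L) : baer E -> forall e : E, exists e', e = x *: e'.
Proof.
move=> EB e; have [|e' e'P] := EB [set p | exists a, p.1 = a * x /\ p.2 = a *: e].
  split=> [|_ [a [/= /esym/x_regular -> ->]]]; last by rewrite scale0r.
  split=> [|l [_ _] [_ _] [a [/= -> ->]] [b [/= -> ->]]].
    by exists 0; rewrite mul0r scale0r.
  exists (l * a + b); split=> /=; first by rewrite [LHS]/(l * _ + _) mulrDl mulrA.
  by rewrite scalerDl scalerA.
by exists e'; apply: e'P; exists 1; rewrite mul1r scale1r.
Qed.

(** A finite injective resolution of L forces the socle of L/xL to be spanned by
    u.  The chain J filters L/(x,u) by residue fields or 0; it lets vanishing of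
    Ext^1(L/m, -) imply vanishing of Ext^1(L/(x,u), -) at each descending step
    through the cocycle modules ker (delta i.+1).  The last step differs since L
    is not divisible by x: instead, the map a |-> a v / x from m to L is traced
    through the resolution. *)
Lemma socle_one_dim (J : nat -> set L) (w : nat -> L) (v : L) d N :
  (forall n, submodule (J n : set L^o)) -> J 0%N = [set: L] ->
  (forall n a, m a -> J n.+1 (a * w n)) ->
  (forall n, J n = [set j + b * w n | j in J n.+1 & b in setT]) ->
  J N = J0 ->
  (forall a, m a -> exists b, a * v = b * x) ->
  injective_dimension_le L^o d -> exists a b, v = a * x + b * u.
Proof.
move=> JS Jtop mJ JE JN v_socle [E [eta [delta [eta_inj ex0 ex inj Ed]]]].
have kerS i : submodule [set y | delta i y = 0].
  split=> [|a y y' /= y0 y'0]; first by rewrite /= linear0.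
  by rewrite linearP y0 y'0 scaler0 addr0.
have dd i y : delta i.+1 (delta i y) = 0 by apply/(ex i); exists y.
have rangeE i : range (delta i) = [set y | delta i.+1 y = 0].
  apply/seteqP; split=> [_ [y _ <-]|y /(ex i)[z <-]]; first exact: dd.
  by exists z.
have bE i : baer (E i) by apply: injective_baer.
have kerJ n i : (d - i <= n)%N -> extends [set y | delta i.+1 y = 0] J0.
  elim: n i => [|n IH] i din.
    move=> G _ _ GC; exists 0; first by rewrite /= linear0.
    by move=> r y _; rewrite scaler0; apply: Ed; lia.
  have [di|id_] := leqP d i; first by apply: IH; lia.
  rewrite -JN; apply: (extends_chain _ JS Jtop mJ JE) => //.
  apply: extends_kernel => //; last by rewrite rangeE; apply: IH; lia.
  move=> y /(ex i)[z <-]; have [z' ->] := baer_divisible (bE i) z.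
  by exists (delta i z'); rewrite ?dd ?linearZ.
(* The map a |-> a v / x from m to L is multiplication by some e in E 0. *)
have [e eP] : exists e : E 0%N, forall a b, m a -> a * v = b * x -> eta b = a *: e.
  have [|e eP] := bE 0%N [set p | exists2 b, m p.1 /\ p.1 * v = b * x & p.2 = eta b].
    split=> [|_ [b [/= _ +] ->]]; last by rewrite mul0r => /esym/x_regular ->; rewrite linear0.
    split=> [|l p q [b [mp pE] pE'] [b' [mq qE] qE']].
      exists 0; last by rewrite linear0.
      by rewrite !mul0r; split=> //; case: m_ideal.
    exists (l * b + b') => /=; last by rewrite pE' qE' linearP.
    split; first by case: m_ideal => _; apply.
    by rewrite [X in X * v]/(l * _ + _) !mulrDl -!mulrA pE qE.
  by exists e => a b ma av; apply: eP; exists b.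
have [||c [xc uc]] := @extends_socle _ _ (delta 0%N) e.
- by rewrite rangeE; apply: kerJ (leqnn _).
- move=> a ma; have [b ab] := v_socle _ ma.
  by rewrite -(eP _ _ ma ab); apply/ex0; exists b.
have [l lE] := iffLR (ex0 _) xc.
have [l' l'E] : exists l', eta l' = e - u *: c.
  by apply/ex0; rewrite linearB uc subrr.
exists l', l; apply: eta_inj.
have eE : e = eta l' + u *: c by rewrite l'E subrK.
have -> : eta v = x *: e by apply: eP; rewrite // mulrC.
rewrite eE scalerDr scalerA [x * u]mulrC -scalerA -lE.
by rewrite -!linearZ -linearD [l' * x]mulrC [l * u]mulrC.
Qed.
End LocalRing.

(** * The localization at the origin *)

(** A localization of a domain, constructed as a ring of fractions in a field. *)

Section DomainLocalization.
Variables (R : comNzRingType) (K : fieldType) (iota : {rmorphism R -> K}).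
Variable P : set R.

Hypothesis iota_inj : injective iota.
Hypothesis P_prime : prime_subset P.

(** The hypotheses are arguments so that unification finds them when it looks
    for the subring structure. *)
Definition local_fractions & injective iota & prime_subset P : {pred K} :=
  fun z => `[< exists a s, ~ P s /\ z = iota a / iota s >].
Local Notation LF := (local_fractions iota_inj P_prime).

Let iota0 s : ~ P s -> iota s != 0.
Proof.
move=> Ps; apply/eqP => s0; apply: Ps; rewrite (_ : s = 0); first by case: P_prime.
by apply: iota_inj; rewrite rmorph0.
Qed.
Let PM s t : ~ P s -> ~ P t -> ~ P (s * t).
Proof. by move=> Ps Pt; case: P_prime => _ _ PP /PP[]. Qed.

Lemma local_fractions_subring : subring_closed LF.
Proof.
split=> [|x y|x y]; rewrite ?unfold_in.
- by apply/asboolP; exists 1, 1; split; [case: P_prime|rewrite rmorph1 divr1].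
- move=> /asboolP[a [s [Ps ->]]] /asboolP[b [t [Pt ->]]]; apply/asboolP.
  exists (a * t - b * s), (s * t); split; first exact: PM.
  by rewrite rmorphB !rmorphM; field; rewrite !iota0.
- move=> /asboolP[a [s [Ps ->]]] /asboolP[b [t [Pt ->]]]; apply/asboolP.
  exists (a * b), (s * t); split; first exact: PM.
  by rewrite !rmorphM mulf_div.
Qed.
HB.instance Definition _ := GRing.isSubringClosed.Build K LF local_fractions_subring.

Record localization := Localization {
  localization_val :> K; _ : localization_val \in LF }.
HB.instance Definition _ := [isSub for localization_val].
HB.instance Definition _ := [Choice of localization by <:].
HB.instance Definition _ := [SubChoice_isSubComNzRing of localization by <:].

Definition localization_unit : pred localization := fun x => `[< exists y, y * x = 1 >].
Definition localization_inv (x : localization) : localization :=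
  if pselect (exists y, y * x = 1) is left h then projT1 (cid h) else x.
Lemma localization_mulV : {in localization_unit, left_inverse 1 localization_inv *%R}.
Proof.
move=> x /asboolP xU; rewrite /localization_inv; case: pselect => // h.
by case: cid.
Qed.
Lemma localization_unitP x y : y * x = 1 -> localization_unit x.
Proof. by move=> yx; apply/asboolP; exists y. Qed.
Lemma localization_inv_out : {in [predC localization_unit], localization_inv =1 id}.
Proof.
move=> x; rewrite inE /= => /asboolP xU; rewrite /localization_inv.
by case: pselect.
Qed.
HB.instance Definition _ := GRing.ComNzRing_hasMulInverse.Build localization
  localization_mulV localization_unitP localization_inv_out.

Lemma localization_mapP a : iota a \in LF.
Proof.
by apply/asboolP; exists a, 1; split; [case: P_prime|rewrite rmorph1 divr1].
Qed.
Definition localization_map a : localization := Localization (localization_mapP a).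
Lemma localization_map_zmod : zmod_morphism localization_map.
Proof. by move=> a b; apply: val_inj; rewrite /= rmorphB. Qed.
Lemma localization_map_monoid : monoid_morphism localization_map.
Proof.
by split=> [|a b]; apply: val_inj; rewrite /= ?rmorph1 ?rmorphM.
Qed.
HB.instance Definition _ := GRing.isZmodMorphism.Build R localization
  localization_map localization_map_zmod.
HB.instance Definition _ := GRing.isMonoidMorphism.Build R localization
  localization_map localization_map_monoid.

Lemma localizationP : is_localization_at P localization_map.
Proof.
have unitV s : ~ P s -> localization_map s \is a GRing.unit.
  move=> Ps; have VS : (iota s)^-1 \in LF.
    by apply/asboolP; exists 1, s; rewrite rmorph1 mul1r.
  apply/unitrPr; exists (Localization VS); apply: val_inj.
  by rewrite rmorphM rmorph1 /= divff ?iota0.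
split=> // [x|a].
  have /asboolP[a [s [Ps xE]]] : val x \in LF := valP x.
  exists a, s; split=> //; apply: (canRL (mulrK (unitV s Ps))); apply: val_inj.
  by rewrite rmorphM /= xE divfK ?iota0.
split=> [a0|[s Ps sa]].
  have /(congr1 val) := a0; rewrite rmorph0 /= => ia0.
  exists 1; first by case: P_prime.
  by rewrite mul1r; apply: iota_inj; rewrite rmorph0.
by apply: (mulrI (unitV s Ps)); rewrite -rmorphM sa mulr0 rmorph0.
Qed.
End DomainLocalization.

Definition vanishes_below (k : fieldType) n (p : {poly k}) :=
  forall i, (i < n)%N -> p`_i = 0.

Lemma vanishes_belowM (k : fieldType) n n' (p q : {poly k}) :
  vanishes_below n p -> vanishes_below n' q -> vanishes_below (n + n') (p * q).
Proof.
move=> pn qn' i i_lt; rewrite coefM big1 // => j _.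
have [jn|nj] := ltnP j n; first by rewrite pn ?mul0r.
by rewrite qn' ?mulr0 //; have := ltn_ord j; lia.
Qed.

Lemma vanishes_belowE (k : fieldType) n (p : {poly k}) :
  vanishes_below n p -> p = 'X^n * drop_poly n p.
Proof.
move=> pn; apply/polyP=> i; rewrite coefXnM coef_drop_poly.
by case: ltnP => [/pn //|ni]; rewrite subnK.
Qed.

Definition pseudo_frobenius (S : natSubmonoid) (a : nat) :=
  ~ submonoid_set S a /\
  forall s, (0 < s)%N -> submonoid_set S s -> submonoid_set S (a + s)%N.

Section LocalizationAtOrigin.
Variables (k : fieldType) (S : natSubmonoid) (c : nat).
Hypothesis Sc : forall i, (c <= i)%N -> submonoid_set S i.
Variables (L : comUnitRingType) (phi : {rmorphism semigroup_ring k S -> L}).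
Hypothesis loc : is_localization_at (@origin_ideal k S) phi.
Local Notation R := (semigroup_ring k S).
Local Notation RS := (@semigroup_poly k S).

Let phiU (s : R) : (val s)`_0 != 0 -> phi s \is a GRing.unit.
Proof. by case: loc => U _ _ s0; apply: U; apply/eqP. Qed.
Let phiF (y : L) : exists r s : R, (val s)`_0 != 0 /\ phi s * y = phi r.
Proof.
case: loc => _ + _ => /(_ y)[a [s [/eqP s0 ->]]]; exists a, s; split=> //.
by rewrite mulrC divrK // phiU.
Qed.
Let phi_inj : injective phi.
Proof.
move=> a b ab; apply/eqP; rewrite -subr_eq0; apply/eqP.
have [_ _ phi0] := loc.
have /phi0[s /eqP s0 sab] : phi (a - b) = 0 by rewrite rmorphB ab subrr.
apply: val_inj; have /(congr1 val)/eqP := sab.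
rewrite rmorphM rmorph0 mulf_eq0 => /orP[/eqP sE|/eqP ->//].
by move: s0; rewrite sE coef0 eqxx.
Qed.

(** The elements of L of order at least n in t, that is, those whose power
    series starts in degree n or later; the maximal ideal is the case n = 1. *)
Definition origin_filtration n : set L :=
  [set y | exists r s : R,
     [/\ (val s)`_0 != 0, vanishes_below n (val r) & phi s * y = phi r]].
Local Notation O := origin_filtration.

Lemma origin_filtration0 : O 0 = [set: L].
Proof.
apply/seteqP; split=> // y _; have [r [s [s0 ys]]] := phiF y.
by exists r, s; split=> // i.
Qed.

Lemma origin_filtrationM n n' a b : O n a -> O n' b -> O (n + n')%N (a * b).
Proof.
move=> [r [s [s0 rn as_]]] [r' [s' [s'0 rn' bs]]].
exists (r * r'), (s * s'); split; last by rewrite !rmorphM -as_ -bs mulrACA.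
  by rewrite rmorphM coef0_mul mulf_neq0.
by rewrite rmorphM; apply: vanishes_belowM.
Qed.

Lemma origin_filtration_submodule n : submodule (O n : set L^o).
Proof.
split=> [|a u v Ou Ov].
  exists 0, 1; split; rewrite ?mulr0 ?rmorph0 //.
    by rewrite rmorph1 coef1 oner_neq0.
  by move=> i _; rewrite ?rmorph0 coef0.
have [r [s [s0 rn us]]] : O n (a * u).
  by rewrite -[n]add0n; apply: origin_filtrationM => //; rewrite origin_filtration0.
have [r' [s' [s'0 rn' vs]]] := Ov.
exists (r * s' + r' * s), (s * s'); split.
- by rewrite rmorphM coef0_mul mulf_neq0.
- move=> i i_n; rewrite rmorphD !rmorphM coefD.
  have v0 (p : {poly k}) : vanishes_below 0 p by [].
  by rewrite (vanishes_belowM rn (v0 _)) ?addn0 // (vanishes_belowM rn' (v0 _)) ?addn0 // addr0.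
- rewrite rmorphD !rmorphM -us -vs mulrDr [a *: u]/(a * u); congr (_ + _).
    by rewrite mulrAC.
  by rewrite [RHS]mulrC mulrA.
Qed.

Lemma origin_filtration_anti n n' : (n <= n')%N -> O n' `<=` O n.
Proof.
move=> nn' y [r [s [s0 rn ys]]]; exists r, s; split=> // i i_n.
by apply: rn; apply: leq_trans nn'.
Qed.

Lemma origin_filtration_poly n (r : R) : vanishes_below n (val r) -> O n (phi r).
Proof.
by move=> rn; exists r, 1; split=> //; rewrite rmorph1 ?mul1r // coef1 oner_neq0.
Qed.

Lemma origin_local a : O 1 a \/ a \is a GRing.unit.
Proof.
have [r [s [s0 ar]]] := phiF a; have [r0|r0] := eqVneq (val r)`_0 0.
  by left; exists r, s; split=> // -[].
by right; have := phiU r0; rewrite -ar unitrMr // phiU.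
Qed.

Let T n (Sn : submonoid_set S n) : R := SemigroupRing (semigroup_polyXn k Sn).

(** The n-th graded piece of the filtration is spanned by t^n or is 0, according
    to whether n is in S. *)
Definition monomial_or0 n : L :=
  if pselect (submonoid_set S n) is left Sn then phi (T Sn) else 0.

Lemma monomial_or0_filtration n : O n (monomial_or0 n).
Proof.
rewrite /monomial_or0; case: pselect => [Sn|_]; last by case: (origin_filtration_submodule n).
by apply: origin_filtration_poly => i i_n; rewrite /= coefXn ltn_eqF.
Qed.

Lemma origin_filtration_step n y : O n y -> exists b z, O n.+1 z /\ y = z + b * monomial_or0 n.
Proof.
move=> [r [s [s0 rn ys]]].
have [Sn|Sn] := pselect (submonoid_set S n); last first.
  exists 0, y; split; last by rewrite mul0r addr0.
  exists r, s; split=> // i; rewrite ltnS leq_eqVlt => /predU1P[->|/rn//].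
  by apply/eqP; apply: contraT => /(elimT (semigroup_polyP _ _) (semigroup_ringP r)).
pose q : R := SemigroupRing (semigroup_polyZ (val r)`_n (rpred1 RS)).
exists (phi q / phi s), (y - phi q / phi s * phi (T Sn)); split; last first.
  by rewrite /monomial_or0; case: pselect => // Sn'; rewrite (Prop_irrelevance Sn' Sn) subrK.
exists (r - q * T Sn), s; split=> //.
  move=> i i_n; rewrite rmorphB rmorphM /= -scalerAl mul1r coefB coefZ coefXn.
  move: i_n; rewrite ltnS leq_eqVlt => /predU1P[->|i_n]; first by rewrite eqxx mulr1 subrr.
  by rewrite rn // ltn_eqF // mulr0 subr0.
by rewrite rmorphB rmorphM -ys mulrBr; congr (_ - _); rewrite mulrA [phi s * _]mulrC divrK ?phiU.
Qed.

(** Beyond the conductor plus e, dividing a power series by t^e leaves its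
    support in S. *)
Lemma deep_filtration e (Se : submonoid_set S e) y : O (c + e)%N y ->
  exists b, y = b * phi (T Se).
Proof.
move=> [r [s [s0 rn ys]]].
have dS : drop_poly e (val r) \in RS.
  apply/semigroup_polyP => i; rewrite coef_drop_poly => ri; apply: Sc.
  by rewrite leqNgt; apply/negP => ic; move/eqP: ri; apply; apply: rn; lia.
exists (phi (SemigroupRing dS) / phi s).
rewrite mulrAC -rmorphM; apply: (canRL (mulrK (phiU s0))); rewrite mulrC ys.
congr (phi _); apply: val_inj; rewrite rmorphM /= mulrC; apply: vanishes_belowE => i ie.
by apply: rn; lia.
Qed.

Lemma pseudo_frobenius_socle a e (Se : submonoid_set S e) (Sae : submonoid_set S (a + e)%N) :
  pseudo_frobenius S a -> forall y, O 1 y -> exists b, y * phi (T Sae) = b * phi (T Se).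
Proof.
move=> [_ aS] y [r [s [s0 r1 ys]]].
have aR : 'X^a * val r \in RS.
  apply/semigroup_polyP => i; rewrite coefXnM; case: ltnP => [_|ai]; first by rewrite eqxx.
  have [i0|i0] := posnP (i - a)%N; first by rewrite i0 r1 ?eqxx.
  by move/(elimT (semigroup_polyP _ _) (semigroup_ringP r))/(aS _ i0); rewrite subnKC.
exists (phi (SemigroupRing aR) / phi s); rewrite [RHS]mulrAC.
apply: (canRL (mulrK (phiU s0))); rewrite mulrAC [y * _]mulrC ys -!rmorphM.
by congr (phi _); apply: val_inj; rewrite !rmorphM /= exprD; ring.
Qed.

(** Clear denominators and compare the coefficients of t^(a'+e): the right side
    has one only if a' is in S or a' - a is in S, and then a' = a or a' is in S
    by the pseudo-Frobenius property of a. *)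
Lemma socle_independent a a' e (Se : submonoid_set S e)
    (Sae : submonoid_set S (a + e)%N) (Sa'e : submonoid_set S (a' + e)%N) :
  pseudo_frobenius S a -> pseudo_frobenius S a' -> a != a' ->
  forall b b', phi (T Sa'e) <> b' * phi (T Se) + b * phi (T Sae).
Proof.
move=> [_ aS] [a'S _] aa' b b' E.
have [r [s [s0 bs]]] := phiF b; have [r' [s' [s'0 b's]]] := phiF b'.
have EX : 'X^a' * (val s * val s') = val r' * val s + 'X^a * (val r * val s').
  apply: (mulIf (monic_neq0 (monicXn k e))).
  have : s * s' * T Sa'e = r' * s * T Se + r * s' * T Sae.
    apply: phi_inj; rewrite rmorphD !rmorphM E -bs -b's; ring.
  move/(congr1 val); rewrite rmorphD !rmorphM /= !exprD => EE.
  by apply: etrans (etrans EE _); ring.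
have /(congr1 (fun p : {poly k} => p`_a')) := EX.
rewrite coefD !coefXnM ltnn subnn coef0_mul => E0.
have r's0 : (val r' * val s)`_a' = 0.
  apply/eqP; apply: contraT => nz; case: a'S; move: nz; apply: (elimT (semigroup_polyP _ _)).
  by apply: rpredM; apply: semigroup_ringP.
move: E0; rewrite r's0 add0r; case: ltnP => [_|aa'_le] E0.
  by move/eqP: E0; rewrite mulf_eq0 (negPf s0) (negPf s'0).
apply: a'S; rewrite -(subnKC aa'_le); apply: aS; first by rewrite subn_gt0 ltn_neqAle aa'.
have : (val r * val s')`_(a' - a) != 0 by rewrite -E0 mulf_neq0.
apply: (elimT (semigroup_polyP _ _)).
by apply: rpredM; apply: semigroup_ringP.
Qed.

Lemma infinite_injective_dimension a a' :
  pseudo_frobenius S a -> pseudo_frobenius S a' -> a != a' ->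
  ~ finite_injective_dimension (L^o : lmodType L).
Proof.
move=> Pa Pa' aa' [d Ld]; pose e := c.+1.
have Se : submonoid_set S e by apply: Sc; rewrite /e.
have Sae n : submonoid_set S (n + e)%N by apply: Sc; rewrite /e; lia.
set x := phi (T Se); set u := phi (T (Sae a)); set v := phi (T (Sae a')).
(* The ideals (x, u) + O n decrease from L to (x, u). *)
pose J n : set L := [set j + g | j in [set p * x + q * u | p in setT & q in setT] & g in O n].
have JS n : submodule (J n : set L^o).
  have [O0 OD] := origin_filtration_submodule n; split.
    exists 0; last by exists 0; rewrite ?addr0.
    by exists 0 => //; exists 0; rewrite // !mul0r addr0.
  move=> l _ _ [_ [p _ [q _ <-]] [g Og <-]] [_ [p' _ [q' _ <-]] [g' Og' <-]].
  exists ((l * p + p') * x + (l * q + q') * u).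
    by exists (l * p + p') => //; exists (l * q + q').
  exists (l * g + g'); first exact: OD.
  have -> : l *: (p * x + q * u + g : L^o) + (p' * x + q' * u + g' : L^o) =
            l * (p * x + q * u + g) + (p' * x + q' * u + g') by [].
  by ring.
have JE n : J n = [set j + p * monomial_or0 n | j in J n.+1 & p in [set: L]].
  apply/seteqP; split=> [_ [j Jj [g /origin_filtration_step[p [z [Oz ->]]] <-]]|].
    exists (j + z); first by exists j => //; exists z.
    by exists p; rewrite ?addrA.
  move=> _ [_ [j Jj [z Oz <-]] [p _ <-]]; exists j => //; exists (z + p * monomial_or0 n).
    have [_ OD] := origin_filtration_submodule n.
    by rewrite addrC; apply: OD; [exact: monomial_or0_filtration|apply: origin_filtration_anti Oz].
  by rewrite addrA.
have JN : J (c + e)%N = [set p * x + q * u | p in [set: L] & q in [set: L]].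
  apply/seteqP; split=> [_ [_ [p _ [q _ <-]] [g /deep_filtration-/(_ Se)[z ->] <-]]|j Jj].
    by exists (p + z) => //; exists q; rewrite // mulrDl addrAC.
  by exists j => //; exists 0; rewrite ?addr0 //; case: (origin_filtration_submodule (c + e)).
have u_nz p : u <> p * x.
  have := @socle_independent a' a e Se (Sae a') (Sae a) Pa' Pa _ 0 p.
  by rewrite mul0r addr0; apply; rewrite eq_sym.
have x_reg p : p * x = 0 -> p = 0.
  have [r [s [s0 ps]]] := phiF p => px0.
  have : phi (r * T Se) = phi 0 by rewrite rmorphM -ps -mulrA px0 mulr0 rmorph0.
  move/phi_inj/(congr1 val)/eqP; rewrite rmorphM rmorph0 mulf_eq0 /= orbC.
  rewrite (negPf (monic_neq0 (monicXn k e))) /= => /eqP r0.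
  apply: (mulrI (phiU s0)); rewrite ps mulr0 (_ : r = 0) ?rmorph0 //; exact: val_inj.
have x_m : O 1 x by apply: origin_filtration_poly => -[|//] _; rewrite /= coefXn.
have OJ n : O n `<=` J n.
  move=> y Oy; exists 0; last by exists y; rewrite ?add0r.
  by exists 0 => //; exists 0; rewrite // !mul0r addr0.
have Jtop : J 0%N = [set: L].
  by apply/seteqP; split=> // y _; apply: OJ; rewrite origin_filtration0.
have mJ n y : O 1 y -> J n.+1 (y * monomial_or0 n).
  move=> Oy; apply: OJ; rewrite -add1n; apply: origin_filtrationM => //.
  exact: monomial_or0_filtration.
have [p [q]] := socle_one_dim (origin_filtration_submodule 1) origin_local
  (pseudo_frobenius_socle Se (Sae a) Pa) u_nz x_reg x_m JS Jtop mJ JE JN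
  (pseudo_frobenius_socle Se (Sae a') Pa') Ld.
apply: socle_independent Pa Pa' aa' q p.
Qed.

End LocalizationAtOrigin.

(** The socle of k[S]/(t^e) at the origin has the t^(a+e) with a
    pseudo-Frobenius as a basis, and a Gorenstein ring has a one-dimensional
    socle. *)
Theorem not_gorenstein (k : fieldType) (S : natSubmonoid) (c a a' : nat) :
  (forall i, (c <= i)%N -> submonoid_set S i) ->
  pseudo_frobenius S a -> pseudo_frobenius S a' -> a != a' ->
  ~ gorenstein_semigroup k S.
Proof.
move=> Sc Pa Pa' aa' [_ gor].
pose K := {fraction {poly k}}.
pose iota : {rmorphism {poly k} -> K} := @FracField.tofrac {poly k}.
pose rho : {rmorphism semigroup_ring k S -> K} := iota \o val.
have rho_inj : injective rho.
  by move=> p q /eqP; rewrite tofrac_eq => /eqP /val_inj.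
have loc := localizationP rho_inj (origin_ideal_prime k S).
apply: (infinite_injective_dimension Sc loc Pa Pa' aa').
exact: gor (origin_ideal_maximal k S) loc.
Qed.

(** * Sally type semigroups *)

Section Sally.
Variables (e m n : nat).
Hypotheses (m2 : (2 <= m)%N) (mn : (m < n)%N) (ne : (n <= e - 2)%N).
Local Notation S := (sally e m n).

(** Sums of two generators cover 2e, ..., 3e-1 except 2e+3 for (m,n) = (2,3):
    m = 1 + (m-1), and n = 1 + (n-1), or n = 2 + (n-2) if n - 1 = m > 2.
    Everything above is reached by adding e, or, for 3e+3 when (m,n) = (2,3), as
    (e+1) + (2e+2). *)
Lemma sallyP x : submonoid_set S x <->
  x = 0%N \/ [/\ (e <= x)%N, x <> (e + m)%N, x <> (e + n)%N &
                 (m, n) = (2, 3)%N -> x <> (2 * e + 3)%N].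
Proof.
split.
  move=> Sx; apply: (Sx [set x | x = 0%N \/ [/\ (e <= x)%N, x <> (e + m)%N, x <> (e + n)%N &
                 (m, n) = (2, 3)%N -> x <> (2 * e + 3)%N]]); split.
    split=> [|y z]; first by left.
    move=> [->|[ey ym yn y3]] [->|[ez zm zn z3]]; [by left| | |]; right.
    - by rewrite add0n.
    - by rewrite addn0.
    split; [lia|lia|lia|].
    by move=> [mE nE]; rewrite mE nE in ym yn zm zn *; lia.
  move=> y [/= ey yg]; right; split; [lia| | |].
  - by move=> ym; apply: yg; left.
  - by move=> yn; apply: yg; right.
  - by move=> _; lia.
have [S0 SD] := submonoidP S.
have gen j : (j < e)%N -> j <> m -> j <> n -> submonoid_set S (e + j)%N.
  move=> je jm jn M [_ AM]; apply: AM; split=> /=; first by lia.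
  by move=> [] /addnI.
have gen2 i j : (i < e)%N -> i <> m -> i <> n -> (j < e)%N -> j <> m -> j <> n ->
    submonoid_set S (2 * e + (i + j))%N.
  move=> ie im i_n je jm jn; rewrite mul2n -addnn addnACA.
  by apply: SD; apply: gen.
have top2 j : (j < e)%N -> ~ (m = 2 /\ n = 3 /\ j = 3)%N -> submonoid_set S (2 * e + j)%N.
  move=> je nj.
  have [jm|jm] := eqVneq j m.
    by rewrite (_ : j = 1 + m.-1)%N; [apply: gen2|]; lia.
  have [jn|jn] := eqVneq j n; last by rewrite -[j]add0n; apply: gen2; lia.
  have [m_n|m_n] := eqVneq n m.+1; last first.
    by rewrite (_ : j = 1 + n.-1)%N; [apply: gen2|]; lia.
  by rewrite (_ : j = 2 + n.-2)%N; [apply: gen2|]; lia.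
move=> [->//|]; elim/ltn_ind: x => x IH [ex xm xn x3].
have [x2|x2] := ltnP x (2 * e).
  by rewrite -(subnKC ex); apply: gen; lia.
have [x3e|x3e] := ltnP x (3 * e).
  rewrite -(subnKC x2); apply: top2; first by lia.
  by move=> [mE [nE xE]]; apply: x3; [rewrite mE nE|lia].
have [[mE [nE xE]]|nx] := pselect (m = 2 /\ n = 3 /\ x = 3 * e + 3)%N.
  rewrite (_ : x = (e + 1) + (2 * e + 2))%N; last by lia.
  by apply: SD; [apply: gen|apply: top2]; lia.
have Se : submonoid_set S e by rewrite [X in submonoid_set S X](esym (addn0 e)); apply: gen; lia.
rewrite -(subnKC ex); apply: SD => //.
apply: IH; first by lia.
split; [lia|lia|lia|move=> [mE nE] xE]; lia.
Qed.

Lemma sally_symmetric : (m, n) = (2, 3)%N ->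
  (forall i, (2 * e + 3 < i)%N -> submonoid_set S i) /\
  (forall i, (i <= 2 * e + 3)%N ->
     submonoid_set S i <-> ~ submonoid_set S (2 * e + 3 - i)%N).
Proof.
move=> mnE; have [mE nE] := mnE; split=> [i ei|i ie].
  by apply/sallyP; right; split; lia.
rewrite !sallyP; split.
  by move=> [i0|[ei im i_n /(_ mnE) i3]] [j0|[ej jm jn /(_ mnE) j3]]; lia.
move=> nj; have [i0|i0] := eqVneq i 0%N; first by left.
by right; split; [apply: contrapT => H|move=> H|move=> H|move=> _ H]; apply: nj;
  (try by left; lia); right; split; lia.
Qed.

Lemma sally_pseudo_frobenius j : (m, n) <> (2, 3)%N -> j = m \/ j = n ->
  pseudo_frobenius S (e + j).
Proof.
move=> mnE jE; split=> [|s s0]; rewrite !sallyP.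
  by move=> [|[_ jm jn _]]; [lia|case: jE => jE; rewrite jE in jm jn].
by move=> [s0'|[es _ _ _]]; [lia|right; split => //; lia].
Qed.
End Sally.

Theorem theorem2p3 (k : fieldType) (e m n : nat)
    (hm : (2 <= m)%N) (hmn : (m < n)%N) (hn : (n <= e - 2)%N) :
  gorenstein_semigroup k (sally e m n) <-> (m, n) = (2, 3)%N.
Proof.
split=> [gor|mnE]; last first.
  by have [SF Ssym] := sally_symmetric hm hmn hn mnE; apply: symmetric_gorenstein SF Ssym.
apply: contrapT => mnE.
apply: (@not_gorenstein k (sally e m n) (2 * e + 4) (e + m) (e + n)) gor.
- by move=> i ei; apply/sallyP => //; right; split; lia.
- by apply: sally_pseudo_frobenius => //; left.
- by apply: sally_pseudo_frobenius => //; right.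
- by rewrite eqn_add2l ltn_eqF.
Qed.
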